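(* For every $\mathcal P\in\{\mathcal G,\mathcal M\}$, the map $\overline{s}:X\to Y$ obtained as the pushout of the map $s:A\to B$ along $j:A\to X$ (all defined in the context) is not a weak equivalence of the q-model structure on $\mathcal P$-multipointed $d$-spaces. Consequently, the q-model category of $\mathcal P$-multipointed $d$-spaces is not left proper, i.e. it is not true that every pushout of a weak equivalence along a q-cofibration is a weak equivalence. More precisely, left properness already fails for the cobase change $j:A\to X$ of the single globular generating q-cofibration $i:\operatorname{Glob}^{\mathcal P}(\varnothing)\to\operatorname{Glob}^{\mathcal P}(\mathsf D^0)$ (the map $s$ being a weak equivalence whose pushout $\overline s$ along $j$ is not a weak equivalence); neither of the state generators $C:\varnothing\to\{0\}$ and $R:\{0,1\}\to\{0\}$ is involved.
   Context: Spaces. Let $I=[0,1]$. A topological space is $\Delta$-generated if its topology is the final topology with respect to all continuous maps from $[0,1]$ (equivalently, from all topological simplices) to it; it is $\Delta$-Hausdorff if the image of every continuous map from $[0,1]$ to it is closed. $\mathsf{Top}$ is the category of $\Delta$-Hausdorff $\Delta$-generated spaces; it is cartesian closed. The $\Delta$-kelleyfication of a space replaces its topology by the final topology with respect to all continuous maps from $[0,1]$ to it. The mapping space $\mathsf{TOP}(U,V)$ is the set of continuous maps with the $\Delta$-kelleyfication of the compact-open topology. Reparametrizations. $\mathcal G$ is the category of nontrivial compact intervals and nondecreasing homeomorphisms, $\mathcal M$ that of nontrivial compact intervals and nondecreasing surjections. $\mathcal G(1,1)$ is the set of nondecreasing homeomorphisms $I\to I$ and $\mathcal M(1,1)$ the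 set of nondecreasing surjective maps $I\to I$ (these are automatically continuous). Multipointed $d$-spaces. For continuous $x,y:I\to U$ with $x(1)=y(0)$, the normalized composition $x*_Ny:I\to U$ is $(x*_Ny)(t)=x(2t)$ for $0\le t\le 1/2$ and $y(2t-1)$ for $1/2\le t\le 1$. A $\mathcal P$-multipointed $d$-space $X$ consists of a space $|X|\in\mathsf{Top}$ (the underlying space), a set of states $X^0\subset|X|$ and a set $\mathbb P^{\mathrm{top}}X$ of continuous paths $I\to|X|$ (execution paths) with endpoints in $X^0$, closed under precomposition by elements of $\mathcal P(1,1)$ and under normalized composition. A map $f:X\to Y$ is a continuous map $|X|\to|Y|$ taking $X^0$ into $Y^0$ (inducing $f^0$) and such that $f\circ\gamma\in\mathbb P^{\mathrm{top}}Y$ for every $\gamma\in\mathbb P^{\mathrm{top}}X$ (inducing $\mathbb P^{\mathrm{top}}f$). For $u,v\in X^0$, the set $\mathbb P^{\mathrm{top}}_{u,v}X$ of execution paths from $u$ to $v$ has the $\Delta$-kelleyfication of the subspace topology of $\mathsf{TOP}(I,|X|)$, and $\mathbb P^{\mathrm{top}}X$ is topologized as the coproduct over $(u,v)\in X^0\times X^0$. Globes. For $Z\in\mathsf{Top}$, $\operatorname{Glob}^{\mathcal P}(Z)$ has underlying space the quotient in $\mathsf{Top}$ of $\{0,1\}\sqcup(Z\times[0,1])$ by $(z,0)\sim0$, $(z,1)\sim1$ for $z\in Z$, states $\{0,1\}$, and execution paths $\delta_z\circ\varphi$ for $z\in Z$, $\varphi\in\mathcal P(1,1)$, where $\delta_z(t)=[z,t]$.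 q-model structure. A map $f$ is a weak equivalence iff $f^0$ is a bijection and $\mathbb P^{\mathrm{top}}f$ is a weak homotopy equivalence. The q-cofibrations are generated by the maps $\operatorname{Glob}^{\mathcal P}(\mathsf S^{n-1})\to\operatorname{Glob}^{\mathcal P}(\mathsf D^n)$ for $n\ge0$ (with $\mathsf S^{-1}=\varnothing$, $\mathsf D^0=\{*\}$) together with $C:\varnothing\to\{0\}$ and $R:\{0,1\}\to\{0\}$ (discrete sets of states without execution paths). The objects. Let $\mathcal V$ be the set of continuous $\gamma:I\to I$ with $\gamma(0)=\gamma(1)=0$; put $m(\gamma)=\max_{t\in I}\gamma(t)$, $\mathcal E_1=\{\gamma\in\mathcal V: m(\gamma)=1\}$ and $\mathcal E_{>0}=\mathcal V\setminus\{0\}$. $A$ and $B$ are the $\mathcal P$-multipointed $d$-spaces with underlying space $I$, set of states $\{0\}$, and $\mathbb P^{\mathrm{top}}A=\mathcal E_1$, $\mathbb P^{\mathrm{top}}B=\mathcal E_{>0}$. The map $s:A\to B$ is induced by the identity of $I$. Let $i:\operatorname{Glob}^{\mathcal P}(\varnothing)\to\operatorname{Glob}^{\mathcal P}(\mathsf D^0)$ be the generating q-cofibration for $n=0$, and let $\operatorname{Glob}^{\mathcal P}(\varnothing)\to A$ send both states to the state $0$ of $A$. $X$ is the pushout of $\operatorname{Glob}^{\mathcal P}(\mathsf D^0)\xleftarrow{\,i\,}\operatorname{Glob}^{\mathcal P}(\varnothing)\to A$, with canonical map $j:A\to X$; $Y$ is the pushout of $X\xleftarrow{\,j\,}A\xrightarrow{\,s\,}B$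 (equivalently, of $\operatorname{Glob}^{\mathcal P}(\mathsf D^0)\xleftarrow{\,i\,}\operatorname{Glob}^{\mathcal P}(\varnothing)\to A\xrightarrow{\,s\,}B$), with canonical map $\overline s:X\to Y$. All pushouts are in the category of all $\mathcal P$-multipointed $d$-spaces. *)

(* Defs.v *)
From HB Require Import structures.
From mathcomp Require Import all_boot all_order all_algebra.
From mathcomp Require Import all_classical all_reals all_analysis.

Set Implicit Arguments.
Unset Strict Implicit.
Unset Printing Implicit Defensive.

Import Order.TTheory GRing.Theory Num.Theory.
Import numFieldNormedType.Exports.

Local Open Scope classical_set_scope.
Local Open Scope ring_scope.

Definition set_elt (T : Type) (A : set T) (x : T) (Ax : A x) : set_type A :=
  exist (fun y => y \in A) x (mem_set Ax).

Definition I01 (R : realType) : topologicalType :=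
  set_type (`[0, 1]%classic : set R).

Section UnitInterval.
Variable R : realType.

Lemma clamp01_subproof (r : R) :
  (`[0, 1]%classic : set R) (Num.max 0 (Num.min 1 r)).
Proof. by rewrite /= in_itv/= le_max lexx/= ge_max ler01/= ge_min lexx. Qed.

Definition clamp01 (r : R) : I01 R := set_elt (clamp01_subproof r).

Definition I0 : I01 R := clamp01 0.
Definition I1 : I01 R := clamp01 1.

Definition ival (t : I01 R) : R := set_val t.

(* On each branch the argument of [clamp01] already lies in [0, 1]. *)
Definition norm_comp (U : Type) (x y : I01 R -> U) : I01 R -> U :=
  fun t => if ival t <= 2^-1 then x (clamp01 (2 * ival t))
           else y (clamp01 (2 * ival t - 1)).

End UnitInterval.

Arguments I0 {R}.
Arguments I1 {R}.
Arguments ival {R}.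
Arguments clamp01 {R}.

Section DeltaSpaces.
Variable R : realType.

(* The preimages of an open set under continuous paths are always open. *)
Definition delta_generated (T : topologicalType) : Prop :=
  forall A : set T,
    (forall p : I01 R -> T, continuous p -> open (p @^-1` A)) -> open A.

Definition delta_hausdorff (T : topologicalType) : Prop :=
  forall p : I01 R -> T, continuous p -> closed (range p).

End DeltaSpaces.

Definition kelley (R : realType) (T : Type) : Type := T.

Section Kelley.
Variables (R : realType) (T : topologicalType).

Definition kelley_open : set_system (kelley R T) :=
  [set A | forall p : I01 R -> T, continuous p -> open (p @^-1` A)].

Lemma kelley_openT : kelley_open setT.
Proof. by move=> p _; rewrite preimage_setT; exact: openT. Qed.

Lemma kelley_openI : setI_closed kelley_open.
Proof.
move=> A B oA oB p cp; rewrite preimage_setI.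
by apply: openI; [exact: oA|exact: oB].
Qed.

Lemma kelley_open_bigU (J : Type) (f : J -> set (kelley R T)) :
  (forall i, kelley_open (f i)) -> kelley_open (\bigcup_i f i).
Proof.
move=> of_ p cp; rewrite preimage_bigcup; apply: bigcup_open => i _.
exact: of_.
Qed.

HB.instance Definition _ := Choice.on (kelley R T).
HB.instance Definition _ := isOpenTopological.Build (kelley R T)
  kelley_openT kelley_openI kelley_open_bigU.

End Kelley.

Definition mapping_space (R : realType) (U V : topologicalType) :
    topologicalType :=
  kelley R (initial_topology
    (id : continuousType U V -> {compact-open, U -> V})).

Section KelleyTheory.
Variable R : realType.

Lemma kelley_openE (T : topologicalType) (A : set (kelley R T)) :
  open A = forall p : I01 R -> T, continuous p -> open (p @^-1` A).
Proof. by []. Qed.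

Lemma kelley_map (T U : topologicalType) (f : T -> U) :
  continuous f -> continuous (f : kelley R T -> kelley R U).
Proof.
move=> cf; apply/continuousP => A; rewrite !kelley_openE => oA p cp.
rewrite -comp_preimage; apply: oA => t; apply: continuous_comp => //.
  exact: cp.
exact: cf.
Qed.

End KelleyTheory.

Section Homotopy.
Variable R : realType.

Definition homotopic_rel (U V : topologicalType) (B : set U) (a b : U -> V) :
    Prop :=
  exists H : U * I01 R -> V,
    [/\ continuous H, forall x, H (x, I0) = a x, forall x, H (x, I1) = b x
      & forall x t, B x -> H (x, t) = a x].

Definition joined_by_path (T : topologicalType) (x y : T) : Prop :=
  exists p : I01 R -> T, [/\ continuous p, p I0 = x & p I1 = y].

Definition cube (n : nat) : topologicalType := 'rV[I01 R]_n.

Definition cube_boundary (n : nat) : set (cube n) :=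
  [set x : 'rV[I01 R]_n | exists i, x 0 i = I0 \/ x 0 i = I1].

(* The elements of pi_n(T, x) are the classes of spheroids up to homotopy
   relative to the boundary of the cube. *)
Definition spheroid (n : nat) (T : topologicalType) (x : T) :
    set (cube n -> T) :=
  [set a | continuous a /\ forall c, cube_boundary c -> a c = x].

Definition pi0_bijective (T U : topologicalType) (f : T -> U) : Prop :=
  (forall x y, joined_by_path (f x) (f y) -> joined_by_path x y) /\
  (forall y, exists x, joined_by_path (f x) y).

(* Group homomorphisms are isomorphisms as soon as they are bijective, so that
   the group structure of pi_n(T, x) need not be mentioned. *)
Definition pin_bijective (n : nat) (T U : topologicalType) (f : T -> U)
    (x : T) : Prop :=
  (forall a b : cube n -> T, spheroid x a -> spheroid x b ->
     homotopic_rel (@cube_boundary n) (f \o a) (f \o b) ->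
     homotopic_rel (@cube_boundary n) a b) /\
  (forall c : cube n -> U, spheroid (f x) c ->
     exists2 a, spheroid x a & homotopic_rel (@cube_boundary n) (f \o a) c).

Definition weak_homotopy_equivalence (T U : topologicalType)
    (f : continuousType T U) : Prop :=
  pi0_bijective f /\ forall n x, (0 < n)%N -> pin_bijective n f x.

End Homotopy.

Inductive reparam_cat := reparam_G | reparam_M.

(* P(1,1). Nondecreasing surjections are continuous: [reparam_continuous]. *)
Definition reparam (R : realType) (P : reparam_cat) : set (I01 R -> I01 R) :=
  match P with
  | reparam_G =>
      [set phi | [/\ {homo phi : s t / ival s <= ival t}, continuous phi &
         exists psi, [/\ continuous psi, cancel phi psi & cancel psi phi]]]
  | reparam_M =>
      [set phi | {homo phi : s t / ival s <= ival t} /\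
                 set_surj setT setT phi]
  end.

Record mdspace (R : realType) (P : reparam_cat) := MDSpace {
  mdsort :> topologicalType;
  mddg : delta_generated R mdsort;
  mddh : delta_hausdorff R mdsort;
  states : set mdsort;
  paths : set (I01 R -> mdsort);
  paths_cts : forall g, paths g -> continuous g;
  paths_ends : forall g, paths g -> states (g I0) /\ states (g I1);
  paths_reparam : forall g phi, paths g -> reparam P phi -> paths (g \o phi);
  paths_comp : forall x y, paths x -> paths y -> x I1 = y I0 ->
    paths (norm_comp x y)
}.

Arguments states {R P} _.
Arguments paths {R P} _.

Record mdmap (R : realType) (P : reparam_cat) (X Y : mdspace R P) := MDMap {
  mdfun :> X -> Y;
  mdfun_cts : continuous mdfun;
  mdfun_states : forall u, states X u -> states Y (mdfun u);
  mdfun_paths : forall g, paths X g -> paths Y (mdfun \o g)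
}.

Definition mapping_fun (R : realType) (U V : topologicalType)
  (g : mapping_space R U V) : U -> V := (g : continuousType U V).

Section PathSpaces.
Variables (R : realType) (P : reparam_cat).

Definition path_set (X : mdspace R P) (u v : X) :
    set (mapping_space R (I01 R) X) :=
  [set g | [/\ paths X (mapping_fun g), mapping_fun g I0 = u
             & mapping_fun g I1 = v]].

Definition path_space (X : mdspace R P) (u v : X) : topologicalType :=
  kelley R (set_type (path_set u v)).

Definition Ptop (X : mdspace R P) : topologicalType :=
  {uv : set_type (states X) * set_type (states X) &
     path_space (set_val uv.1) (set_val uv.2)}.

Variables (X Y : mdspace R P) (f : mdmap X Y).

Lemma state_map_subproof (u : set_type (states X)) :
  states Y (f (set_val u)).
Proof. by apply: mdfun_states; exact: set_valP. Qed.

Definition state_map (u : set_type (states X)) : set_type (states Y) :=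
  set_elt (state_map_subproof u).

Definition mapping_comp (g : mapping_space R (I01 R) X) :
    mapping_space R (I01 R) Y :=
  (mkcts (fun x => continuous_comp (@cts_fun _ _ (g : continuousType _ _) x)
                                   (@mdfun_cts _ _ _ _ f _))
   : continuousType (I01 R) Y).

Lemma path_map_subproof (u v : X) (g : set_type (path_set u v)) :
  path_set (f u) (f v) (mapping_comp (set_val g)).
Proof.
have [/= pg g0 g1] := set_valP g.
by split; [exact: (mdfun_paths f pg)|exact: congr1 g0|exact: congr1 g1].
Qed.

Definition path_map (u v : X) (g : path_space u v) : path_space (f u) (f v) :=
  set_elt (path_map_subproof (g : set_type (path_set u v))).

Definition Ptop_map (g : Ptop X) : Ptop Y :=
  existT _ (state_map (projT1 g).1, state_map (projT1 g).2)
         (path_map (projT2 g)).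

Lemma mapping_comp_continuous : continuous mapping_comp.
Proof.
apply: kelley_map; apply: continuous_comp_initial.
have -> : (id : continuousType (I01 R) Y -> {compact-open, I01 R -> Y})
    \o mapping_comp = (fun h : {compact-open, I01 R -> X} =>
    (f \o h : {compact-open, I01 R -> Y})) \o
    (id : continuousType (I01 R) X -> {compact-open, I01 R -> X}) by [].
move=> g; apply: continuous_comp; first exact: initial_continuous.
have FF : Filter (nbhs (g : {compact-open, I01 R -> X})) by exact: nbhs_filter.
apply/(@compact_open_cvgP _ _ _ _ (fmap_filter _ FF)) => K O cK oO /= sfO.
have oU : open (f @^-1` O) by move/continuousP: (@mdfun_cts _ _ _ _ f); apply.
have oKU := @compact_open_open _ _ K _ cK oU.
have gK : [set h : {compact-open, I01 R -> X} | h @` K `<=` f @^-1` O] g.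
  by move=> _ [t Kt <-]; apply: sfO; exists t.
apply: (filterS _ (open_nbhs_nbhs (conj oKU gK))) => h /= sh _ [t Kt <-].
by apply: (sh (h t)); exists t.
Qed.

Lemma path_map_continuous (u v : X) : continuous (@path_map u v).
Proof.
apply: kelley_map; apply: continuous_comp_initial.
move=> g; apply: (@continuous_comp _ _ _ set_val mapping_comp).
  exact: initial_continuous.
exact: mapping_comp_continuous.
Qed.

Lemma Ptop_map_continuous : continuous Ptop_map.
Proof.
apply/continuousP => A /sigT_openP oA; apply/sigT_openP => uv.
move/continuousP: (@path_map_continuous (set_val uv.1) (set_val uv.2)).
by move=> /(_ _ (oA (state_map uv.1, state_map uv.2))).
Qed.

End PathSpaces.

Definition Ptop_cts (R : realType) (P : reparam_cat) (X Y : mdspace R P)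
    (f : mdmap X Y) : continuousType (Ptop X) (Ptop Y) :=
  mkcts (@Ptop_map_continuous R P X Y f).

Section Category.
Variables (R : realType) (P : reparam_cat).

Definition is_pushout (A B X Y : mdspace R P) (f : mdmap A B) (g : mdmap A X)
    (f' : mdmap X Y) (g' : mdmap B Y) : Prop :=
  f' \o g =1 g' \o f /\
  forall (Z : mdspace R P) (u : mdmap X Z) (v : mdmap B Z),
    u \o g =1 v \o f ->
    exists h : mdmap Y Z, [/\ h \o f' =1 u, h \o g' =1 v &
      forall h' : mdmap Y Z, h' \o f' =1 u -> h' \o g' =1 v -> h' =1 h].

Definition llp (A B X Y : mdspace R P) (c : mdmap A B) (p : mdmap X Y) : Prop :=
  forall (u : mdmap A X) (v : mdmap B Y), p \o u =1 v \o c ->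
    exists2 h : mdmap B X, h \o c =1 u & p \o h =1 v.

(* [q (z, t)] is the point [z, t] of |Glob(Z)|, and [q0], [q1] are the images of
   0 and 1. The kelleyfication of Z * [0, 1] is the binary product of Top, and
   the universal property is that of the quotient of {0, 1} + Z * [0, 1] in
   Top. *)
Definition is_globe (Z : topologicalType) (G : mdspace R P) (q0 q1 : G)
    (q : kelley R (Z * I01 R)%type -> G) : Prop :=
  [/\ [/\ continuous q, forall z, q (z, I0) = q0 & forall z, q (z, I1) = q1],
      forall (W : topologicalType) (w0 w1 : W)
        (r : kelley R (Z * I01 R)%type -> W),
        delta_generated R W -> delta_hausdorff R W ->
        continuous r -> (forall z, r (z, I0) = w0) ->
        (forall z, r (z, I1) = w1) ->
        exists h : G -> W, [/\ continuous h, h q0 = w0, h q1 = w1, h \o q =1 r &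
          forall h' : G -> W, continuous h' -> h' q0 = w0 -> h' q1 = w1 ->
            h' \o q =1 r -> h' =1 h],
      states G = [set q0; q1]
    & paths G = [set g | exists z, exists2 phi, reparam P phi &
                           g = fun t => q (z, phi t)]].

End Category.

Definition disk (R : realType) (n : nat) : topologicalType :=
  set_type [set x : 'rV[R]_n | \sum_(i < n) x 0 i ^+ 2 <= 1].

(* The sphere of dimension n - 1; it is empty for n = 0. *)
Definition disk_boundary (R : realType) (n : nat) : topologicalType :=
  set_type [set x : 'rV[R]_n | \sum_(i < n) x 0 i ^+ 2 = 1].

Lemma disk_incl_subproof (R : realType) (n : nat) (x : disk_boundary R n) :
  [set x : 'rV[R]_n | \sum_(i < n) x 0 i ^+ 2 <= 1] (set_val x).
Proof. by have /= -> := set_valP x. Qed.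

Definition disk_incl (R : realType) (n : nat) (x : disk_boundary R n) :
  disk R n := set_elt (disk_incl_subproof x).

Section Discrete.
Variables (R : realType) (P : reparam_cat) (T : choiceType).

Lemma discrete_dg : delta_generated R (discrete_topology T).
Proof. by move=> A _; exact: discrete_open. Qed.

Lemma discrete_dh : delta_hausdorff R (discrete_topology T).
Proof. by move=> p _; exact: discrete_closed. Qed.

Definition discrete_md : mdspace R P :=
  @MDSpace R P (discrete_topology T) discrete_dg discrete_dh setT set0
    (fun _ => False_ind _) (fun _ => False_ind _) (fun _ _ => False_ind _)
    (fun _ _ => False_ind _).

End Discrete.

Section ModelStructure.
Variables (R : realType) (P : reparam_cat).

Definition globe_inclusion (n : nat) (G G' : mdspace R P) (g : mdmap G G') :
    Prop :=
  exists q0 q1 q q0' q1' q',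
    [/\ @is_globe R P (disk_boundary R n) G q0 q1 q,
        @is_globe R P (disk R n) G' q0' q1' q', g q0 = q0', g q1 = q1'
      & forall z t, g (q (z, t)) = q' (disk_incl z, t)].

Inductive generating_qcofibration : forall X Y : mdspace R P,
    mdmap X Y -> Prop :=
| gen_globe n (G G' : mdspace R P) (g : mdmap G G') :
    globe_inclusion n g -> generating_qcofibration g
| gen_C (g : mdmap (discrete_md R P void) (discrete_md R P unit)) :
    generating_qcofibration g
| gen_R (g : mdmap (discrete_md R P bool) (discrete_md R P unit)) :
    generating_qcofibration g.

Definition qcofibration (A B : mdspace R P) (c : mdmap A B) : Prop :=
  forall (X Y : mdspace R P) (p : mdmap X Y),
    (forall (G G' : mdspace R P) (g : mdmap G G'),
       generating_qcofibration g -> llp g p) ->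
    llp c p.

Definition weak_equivalence (X Y : mdspace R P) (f : mdmap X Y) : Prop :=
  set_bij (states X) (states Y) f /\ weak_homotopy_equivalence R (Ptop_cts f).

Definition left_proper : Prop :=
  forall (A B X Y : mdspace R P) (w : mdmap A B) (c : mdmap A X)
    (w' : mdmap X Y) (c' : mdmap B Y),
    weak_equivalence w -> qcofibration c -> is_pushout w c w' c' ->
    weak_equivalence w'.

End ModelStructure.

Section ClosedCurves.
Variable R : realType.

(* The supremum is attained since [0, 1] is compact. *)
Definition height (g : I01 R -> I01 R) : R := sup (range (ival \o g)).

Definition loops : set (I01 R -> I01 R) :=
  [set g | [/\ continuous g, g I0 = I0 & g I1 = I0]].

Definition loops_full : set (I01 R -> I01 R) :=
  [set g | loops g /\ height g = 1].

Definition loops_nonzero : set (I01 R -> I01 R) := loops `\ cst I0.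

Lemma I01_dg : delta_generated R (I01 R).
Proof. by move=> A oA; apply: (oA id) => t; exact: cvg_id. Qed.

Lemma ival_continuous : continuous (ival : I01 R -> R).
Proof. exact: initial_continuous. Qed.

Lemma ival_inj : injective (ival : I01 R -> R).
Proof. exact: val_inj. Qed.

Lemma ival01 (t : I01 R) : 0 <= ival t <= 1.
Proof. by have := set_valP t; rewrite /= in_itv. Qed.

Lemma clamp01K (r : R) : 0 <= r <= 1 -> ival (clamp01 r) = r.
Proof.
by move=> /andP[r0 r1]; rewrite /ival /clamp01 /set_elt set_valE /= min_r// max_r.
Qed.

Lemma ivalK (t : I01 R) : clamp01 (ival t) = t.
Proof. by apply: ival_inj; rewrite clamp01K// ival01. Qed.

Lemma ival0 : ival (I0 : I01 R) = 0.
Proof. by rewrite clamp01K// lexx ler01. Qed.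

Lemma ival1 : ival (I1 : I01 R) = 1.
Proof. by rewrite clamp01K// lexx ler01. Qed.

Lemma clamp01_continuous : continuous (clamp01 : R -> I01 R).
Proof.
apply: continuous_comp_initial => r.
have -> : set_val \o @clamp01 R = fun r : R => Num.max 0 (Num.min 1 r) by [].
apply: continuous_max; first exact: cst_continuous.
apply: continuous_min; first exact: cst_continuous.
exact: cvg_id.
Qed.

Lemma I01_hausdorff : hausdorff_space (I01 R).
Proof.
move=> x y clxy; apply: ival_inj; apply: (@Rhausdorff R) => A B Ax By.
have [z [Az Bz]] := clxy _ _ (ival_continuous Ax) (ival_continuous By).
by exists (ival z).
Qed.

Lemma I01_compact : compact [set: I01 R].
Proof.
have -> : [set: I01 R] = clamp01 @` `[0, 1]%classic.
  apply/seteqP; split=> // t _; exists (ival t); last exact: ivalK.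
  by rewrite /= in_itv /= ival01.
apply: continuous_compact; last exact: segment_compact.
by apply: continuous_subspaceT; exact: clamp01_continuous.
Qed.

Lemma I01_dh : delta_hausdorff R (I01 R).
Proof.
move=> p cp; apply: compact_closed; first exact: I01_hausdorff.
apply: continuous_compact I01_compact.
by apply: continuous_subspaceT.
Qed.

Lemma norm_comp_continuous (U : topologicalType) (x y : I01 R -> U) :
  continuous x -> continuous y -> x I1 = y I0 -> continuous (norm_comp x y).
Proof.
move=> cx cy xy.
pose x' (t : I01 R) := x (clamp01 (2 * ival t)).
pose y' (t : I01 R) := y (clamp01 (2 * ival t - 1)).
have c2 : continuous (fun t : I01 R => 2 * ival t).
  by move=> t; apply: (@continuous_comp _ _ _ ival ( *%R 2));
    [exact: ival_continuous|exact: mulrl_continuous].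
have cx' : continuous x'.
  move=> t; apply: (@continuous_comp _ _ _ (fun t => clamp01 (2 * ival t)) x).
    by apply: (@continuous_comp _ _ _ (fun t => 2 * ival t) clamp01);
      [exact: c2|exact: clamp01_continuous].
  exact: cx.
have cy' : continuous y'.
  move=> t; apply: (@continuous_comp _ _ _ (fun t => clamp01 (2 * ival t - 1)) y).
    apply: (@continuous_comp _ _ _ (fun t => 2 * ival t - 1) clamp01).
      exact: (cvgB (c2 t) (cvg_cst (1 : R))).
    exact: clamp01_continuous.
  exact: cy.
move=> t; have [tlt|tgt|teq] := ltgtP (ival t) 2^-1.
- move=> A At; have Ax : nbhs (x' t) A by move: At; rewrite /norm_comp (ltW tlt).
  have nt : (nbhs t) [set s | ival s < 2^-1].
    exact: (@ival_continuous t _ (lt_nbhsl tlt)).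
  rewrite nbhs_simpl.
  apply: (@filterS2 _ (nbhs t) _ _ _ _ _ (cx' t _ Ax) nt) => s /= xs slt.
  by rewrite /norm_comp (ltW slt).
- move=> A At; have Ay : nbhs (y' t) A by move: At; rewrite /norm_comp leNgt tgt.
  have nt : (nbhs t) [set s | 2^-1 < ival s].
    exact: (@ival_continuous t _ (lt_nbhsr tgt)).
  rewrite nbhs_simpl.
  apply: (@filterS2 _ (nbhs t) _ _ _ _ _ (cy' t _ Ay) nt) => s /= ys sgt.
  by rewrite /norm_comp leNgt sgt.
- have h1 : 2 * ival t = 1 by rewrite teq divff.
  have xt : norm_comp x y t = x' t by rewrite /norm_comp /x' teq lexx.
  have yt : norm_comp x y t = y' t.
    by rewrite xt /x' /y' h1 subrr; exact: xy.
  move=> A At; have Ax : nbhs (x' t) A by rewrite -xt.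
  have Ay : nbhs (y' t) A by rewrite -yt.
  apply: (@filterS2 _ (nbhs t) _ _ _ _ _ (cx' t _ Ax)
    (cy' t _ Ay)) => s /= xs ys.
  by rewrite /norm_comp; case: ifP.
Qed.

Lemma norm_comp0 (U : Type) (x y : I01 R -> U) : norm_comp x y I0 = x I0.
Proof. by rewrite /norm_comp ival0 invr_ge0 ler0n mulr0. Qed.

Lemma norm_comp1 (U : Type) (x y : I01 R -> U) : norm_comp x y I1 = y I1.
Proof.
rewrite /norm_comp ival1 ifF; first by rewrite mulr1 mulr2n addrK.
by apply/negbTE; rewrite -ltNge invf_lt1 ?ltr1n ?ltr0n.
Qed.

Lemma range_norm_comp (U : Type) (x y : I01 R -> U) :
  range x `<=` range (norm_comp x y).
Proof.
move=> _ [t _ <-]; have /andP[t0 t1] := ival01 t.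
have E : ival (clamp01 (ival t / 2)) = ival t / 2.
  by rewrite clamp01K// divr_ge0//= ler_pdivrMr// (le_trans t1)// ler_peMr// ler1n.
exists (clamp01 (ival t / 2)) => //; rewrite /norm_comp E.
by rewrite ler_pdivrMr// mulVf// t1 mulrC divfK// ivalK.
Qed.

Lemma reparam_ends (P : reparam_cat) (phi : I01 R -> I01 R) :
  reparam P phi -> phi I0 = I0 /\ phi I1 = I1.
Proof.
have H : {homo phi : s t / ival s <= ival t} ->
    (forall s, exists t, phi t = s) ->
    phi I0 = I0 /\ phi I1 = I1.
  move=> mon surj; split; apply: ival_inj; apply/eqP; rewrite eq_le.
    have [t pt] := surj I0; apply/andP; split; last first.
      by rewrite ival0; have /andP[] := ival01 (phi I0).
    rewrite -[in leRHS]pt; apply: mon.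
    by rewrite ival0; have /andP[] := ival01 t.
  have [t pt] := surj I1; apply/andP; split.
    by rewrite ival1; have /andP[] := ival01 (phi I1).
  rewrite -[in leLHS]pt; apply: mon.
  by rewrite ival1; have /andP[] := ival01 t.
case: P => /=.
  by move=> [mon _ [psi [_ _ pK]]]; apply: H => // s; exists (psi s).
by move=> [mon surj]; apply: H => // s; have [t _ <-] := surj s I; exists t.
Qed.

Lemma reparam_surj (P : reparam_cat) (phi : I01 R -> I01 R) :
  reparam P phi -> forall s, exists t, phi t = s.
Proof.
case: P => /=; first by move=> [_ _ [psi [_ _ pK]]] s; exists (psi s).
by move=> [_ surj] s; have [t _ <-] := surj s I; exists t.
Qed.

Lemma reparam_continuous (P : reparam_cat) (phi : I01 R -> I01 R) :
  reparam P phi -> continuous phi.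
Proof.
case: P => /= [[]//|[mon surj]]; apply: continuous_comp_initial => t.
have lt_mon s r : ival (phi s) < ival (phi r) -> ival s < ival r.
  by move=> sr; rewrite ltNge; apply: contraL sr => /mon; rewrite -leNgt.
have FF : Filter (nbhs t) := nbhs_filter t.
apply/cvgrPdist_lt => e e0; near=> r; rewrite distrC ltr_distl; apply/andP; split.
- near: r; have [lt0|ge0] := ltP (ival (phi t) - e) 0.
    apply: nearW => r; apply: lt_le_trans lt0 _.
    by have /andP[] := ival01 (phi r).
  have : 0 <= ival (phi t) - e / 2 <= 1.
    have /andP[_ p1] := ival01 (phi t); rewrite (le_trans ge0)/=.
      by rewrite lerBlDr (le_trans p1)// lerDl divr_ge0// ltW.
    by rewrite lerD2l lerN2 ler_pdivrMr// ler_peMr ?ler1n// ltW.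
  move=> /clamp01K dE; have [s _ sE] := surj (clamp01 (ival (phi t) - e / 2)) I.
  have st : ival s < ival t.
    by apply: lt_mon; rewrite sE dE ltrBlDr ltrDl divr_gt0.
  have nt : nbhs t [set r | ival s < ival r].
    exact: (@ival_continuous t _ (lt_nbhsr st)).
  apply: (filterS _ nt) => r /= /ltW /mon.
  apply: lt_le_trans; rewrite sE dE ltrD2l ltrN2 ltr_pdivrMr//.
  by rewrite ltr_pMr// ltr1n.
- near: r; have [gt1|le1] := ltP 1 (ival (phi t) + e).
    apply: nearW => r; apply: le_lt_trans gt1.
    by have /andP[] := ival01 (phi r).
  have : 0 <= ival (phi t) + e / 2 <= 1.
    have /andP[p0 _] := ival01 (phi t); apply/andP; split.
      by rewrite addr_ge0// divr_ge0// ltW.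
    by rewrite (le_trans _ le1)// lerD2l ler_pdivrMr// ler_peMr ?ler1n// ltW.
  move=> /clamp01K dE; have [s _ sE] := surj (clamp01 (ival (phi t) + e / 2)) I.
  have ts : ival t < ival s.
    by apply: lt_mon; rewrite sE dE ltrDl divr_gt0.
  have nt : nbhs t [set r | ival r < ival s].
    exact: (@ival_continuous t _ (lt_nbhsl ts)).
  apply: (filterS _ nt) => r /= /ltW /mon.
  move=> /le_lt_trans; apply; rewrite sE dE ltrD2l ltr_pdivrMr//.
  by rewrite ltr_pMr// ltr1n.
Unshelve. all: by end_near. Qed.

Lemma loops_reparam (P : reparam_cat) (g phi : I01 R -> I01 R) :
  loops g -> reparam P phi -> loops (g \o phi).
Proof.
move=> [cg g0 g1] phiP; have [p0 p1] := reparam_ends phiP.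
split; rewrite /= ?p0 ?p1// => t.
by apply: continuous_comp; [exact: reparam_continuous phiP _|exact: cg].
Qed.

Lemma loops_comp (x y : I01 R -> I01 R) :
  loops x -> loops y -> loops (norm_comp x y).
Proof.
move=> [cx x0 x1] [cy y0 y1]; split; rewrite ?norm_comp0 ?norm_comp1//.
by apply: norm_comp_continuous => //; rewrite x1 y0.
Qed.

Lemma loops_full_reparam (P : reparam_cat) (g phi : I01 R -> I01 R) :
  loops_full g -> reparam P phi -> loops_full (g \o phi).
Proof.
move=> [lg hg] phiP; split; first exact: loops_reparam lg phiP.
rewrite -hg /height; congr sup; apply/seteqP; split=> _ [t _ <-] /=.
  by exists (phi t).
by have [s <-] := reparam_surj phiP t; exists s.
Qed.

Lemma loops_full_comp (x y : I01 R -> I01 R) :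
  loops_full x -> loops_full y -> loops_full (norm_comp x y).
Proof.
move=> [lx hx] [ly _]; split; first exact: loops_comp.
have ub1 (g : I01 R -> I01 R) : ubound (range (ival \o g)) 1.
  by move=> _ [t _ <-] /=; have /andP[] := ival01 (g t).
have ne (g : I01 R -> I01 R) : range (ival \o g) !=set0.
  by exists (ival (g I0)), I0.
apply/eqP; rewrite eq_le; apply/andP; split; first exact: ge_sup.
rewrite -hx; apply: ge_sup => // _ [t _ <-]; apply: ub_le_sup.
  by exists 1; exact: ub1.
have [s _ /= sE] : range (norm_comp x y) (x t) by apply: range_norm_comp; exists t.
by exists s => //=; rewrite sE.
Qed.

Lemma loops_nonzero_reparam (P : reparam_cat) (g phi : I01 R -> I01 R) :
  loops_nonzero g -> reparam P phi -> loops_nonzero (g \o phi).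
Proof.
move=> [lg g_neq] phiP; split; first exact: loops_reparam lg phiP.
move=> gphi; apply: g_neq; apply/funext => t.
by have [s <-] := reparam_surj phiP t; exact: (congr1 (@^~ s) gphi).
Qed.

Lemma loops_nonzero_comp (x y : I01 R -> I01 R) :
  loops_nonzero x -> loops_nonzero y -> loops_nonzero (norm_comp x y).
Proof.
move=> [lx x_neq] [ly _]; split; first exact: loops_comp.
move=> xy; apply: x_neq; apply/funext => t.
have [s _ <-] : range (norm_comp x y) (x t) by apply: range_norm_comp; exists t.
by rewrite xy.
Qed.

Variable P : reparam_cat.

Lemma spaceA_ends (g : I01 R -> I01 R) :
  loops_full g -> [set I0] (g I0) /\ [set I0] (g I1).
Proof. by case=> -[_ ? ?] _. Qed.

Lemma spaceB_ends (g : I01 R -> I01 R) :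
  loops_nonzero g -> [set I0] (g I0) /\ [set I0] (g I1).
Proof. by case=> -[_ ? ?] _. Qed.

Lemma spaceA_cts (g : I01 R -> I01 R) : loops_full g -> continuous g.
Proof. by case=> -[]. Qed.

Lemma spaceB_cts (g : I01 R -> I01 R) : loops_nonzero g -> continuous g.
Proof. by case=> -[]. Qed.

Definition spaceA : mdspace R P :=
  @MDSpace R P (I01 R) I01_dg I01_dh [set I0] loops_full
    spaceA_cts spaceA_ends (@loops_full_reparam P)
    (fun x y px py _ => loops_full_comp px py).

Definition spaceB : mdspace R P :=
  @MDSpace R P (I01 R) I01_dg I01_dh [set I0] loops_nonzero
    spaceB_cts spaceB_ends (@loops_nonzero_reparam P)
    (fun x y px py _ => loops_nonzero_comp px py).

Lemma loops_full_nonzero (g : I01 R -> I01 R) :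
  loops_full g -> loops_nonzero g.
Proof.
move=> [lg hg]; split=> // g0; move: hg; rewrite g0 /height.
have E : ival \o cst I0 = cst 0 :> (I01 R -> R).
  by apply/funext => t /=; exact: ival0.
rewrite E (_ : range _ = [set 0]) ?sup1.
  by move/esym/eqP; rewrite oner_eq0.
by apply/seteqP; split=> [_ [t _ <-]|_ ->] //=; exists I0.
Qed.

Lemma id_cts : continuous (fun t : I01 R => t).
Proof. by move=> t; exact: cvg_id. Qed.

Definition map_s : mdmap spaceA spaceB :=
  @MDMap R P spaceA spaceB (fun t => t) id_cts (fun _ u0 => u0)
    loops_full_nonzero.

End ClosedCurves.

Arguments spaceA R P : clear implicits.
Arguments spaceB R P : clear implicits.
Arguments map_s R P : clear implicits.

(* [X] is the pushout of [i] and [a], and [Y] that of [map_s] and [j]. *)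
Definition pushout_diagram (R : realType) (P : reparam_cat)
    (G0 G1 X Y : mdspace R P) (i : mdmap G0 G1) (a : mdmap G0 (spaceA R P))
    (j : mdmap (spaceA R P) X) (k : mdmap G1 X)
    (sbar : mdmap X Y) (l : mdmap (spaceB R P) Y) : Prop :=
  [/\ globe_inclusion 0 i,
      forall u, states G0 u -> a u = I0,
      is_pushout i a j k
    & is_pushout (map_s R P) j sbar l].

(* Main.v *)
Require Import Defs.
From mathcomp Require Import all_boot all_order all_algebra.
From mathcomp Require Import all_classical all_reals all_analysis.
From mathcomp Require Import lra.

(** The inclusion of loops of height 1 into nonzero loops is a strong
    deformation retract: a nonzero loop [g] is carried linearly onto
    [g / height g]. Hence [map_s] is a weak equivalence
    ([map_s_weak_equivalence]). The only topological difficulty is that the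
    path spaces carry a kelleyfied topology. It is settled once and for all by
    [Ptop_lift] and [path_fun_continuous], which say that a map from a
    Delta-generated space [Z] to the execution paths with given endpoints is
    continuous exactly when the adjoint map on [Z * [0, 1]] is, and by [prod_I01_dg]:
    multiplying by [0, 1] preserves Delta-generated spaces.

    Gluing both ends of a directed segment [d] to 0 destroys the equivalence
    ([pushout_not_weak_equivalence]). In the pushout [Y], the execution paths
    [d] and [g * d], for a loop [g] of height 1, lie in the same path component:
    let both the height of the loop and the time spent on it be [t], and let
    [t] tend to 0. For [t > 0] this is [(t g) * d] up to a reparametrization,
    and for [t = 0] it is [d] ([shrinking_path]). For [0 < t < 1], the loop
    [t g] is an execution path of [B], but not of [A]. In the pushout [X], the two paths lie in
    different components: [X] maps to the multipointed d-space on [0, 1] whose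
    execution paths are the loops of height 0 or 1, by the identity on [A] and
    by collapsing the segment. The height of the image is a continuous function
    on the space of execution paths of [X], with values in [{0, 1}], which
    separates the two paths ([joined_height]).

    Both arguments only use the universal properties. The existence of the
    pushouts ([pushout_diagram_exists]) is shown on a planar model: a segment
    attached at one end to a closed curve, with the execution paths generated by
    those of the two pieces. *)

Set Implicit Arguments.
Unset Strict Implicit.
Unset Printing Implicit Defensive.

Import Order.TTheory GRing.Theory Num.Theory.
Import numFieldNormedType.Exports.

Local Open Scope classical_set_scope.
Local Open Scope ring_scope.

(** * Continuity *)

Section Continuity.

Lemma cts_comp (T U V : topologicalType) (f : T -> U) (g : U -> V) :
  continuous f -> continuous g -> continuous (fun x => g (f x)).
Proof.
by move=> cf cg x; apply: (@continuous_comp _ _ _ f g); [exact: cf|exact: cg].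
Qed.

Lemma cts_fst (T U : topologicalType) : continuous (@fst T U).
Proof. by move=> x; exact: cvg_fst. Qed.

Lemma cts_snd (T U : topologicalType) : continuous (@snd T U).
Proof. by move=> x; exact: cvg_snd. Qed.

Lemma cts_pair (T U V : topologicalType) (f : T -> U) (g : T -> V) :
  continuous f -> continuous g -> continuous (fun x => (f x, g x)).
Proof. by move=> cf cg x; apply: cvg_pair; [exact: cf|exact: cg]. Qed.

Variables (R : realType) (T : topologicalType).
Implicit Types f g : T -> R.

Lemma cts_add f g :
  continuous f -> continuous g -> continuous (fun x => f x + g x).
Proof. by move=> cf cg x; apply: cvgD; [exact: cf|exact: cg]. Qed.

Lemma cts_sub f g :
  continuous f -> continuous g -> continuous (fun x => f x - g x).
Proof. by move=> cf cg x; apply: cvgB; [exact: cf|exact: cg]. Qed.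

Lemma cts_opp f : continuous f -> continuous (fun x => - f x).
Proof. by move=> cf x; apply: cvgN; exact: cf. Qed.

Lemma cts_mul f g :
  continuous f -> continuous g -> continuous (fun x => f x * g x).
Proof. by move=> cf cg x; apply: cvgM; [exact: cf|exact: cg]. Qed.

Lemma cts_norm f : continuous f -> continuous (fun x => `|f x|).
Proof. by move=> cf x; apply: cvg_norm; exact: cf. Qed.

Lemma cts_inv f :
  (forall x, f x != 0) -> continuous f -> continuous (fun x => (f x)^-1).
Proof. by move=> f0 cf x; apply: cvgV; [exact: f0|exact: cf]. Qed.

Lemma cts_min f g :
  continuous f -> continuous g -> continuous (fun x => Num.min (f x) (g x)).
Proof. by move=> cf cg x; apply: continuous_min; [exact: cf|exact: cg]. Qed.

Lemma cts_max f g :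
  continuous f -> continuous g -> continuous (fun x => Num.max (f x) (g x)).
Proof. by move=> cf cg x; apply: continuous_max; [exact: cf|exact: cg]. Qed.

End Continuity.

Lemma discrete_cts (D : choiceType) (T : topologicalType)
  (f : discrete_topology D -> T) : continuous f.
Proof. by apply/continuousP => A _; exact: discrete_open. Qed.

Lemma paste_continuous (R : realType) (T U : topologicalType) (d : T -> R)
    (f g : T -> U) :
  continuous d -> continuous f -> continuous g ->
  (forall x, d x = 0 -> f x = g x) ->
  continuous (fun x => if d x <= 0 then f x else g x).
Proof.
move=> cd cf cg fg x; have [dlt|dgt|deq] := ltgtP (d x) 0.
- move=> A; rewrite (ltW dlt) => fA.
  have nx : nbhs x [set y | d y < 0] := cd x _ (lt_nbhsl dlt).
  rewrite nbhs_simpl.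
  apply: (@filterS2 _ (nbhs x) _ _ _ _ _ (cf x _ fA) nx) => y /= fy dy.
  by rewrite (ltW dy).
- move=> A; rewrite leNgt dgt /= => gA.
  have nx : nbhs x [set y | 0 < d y] := cd x _ (lt_nbhsr dgt).
  rewrite nbhs_simpl.
  apply: (@filterS2 _ (nbhs x) _ _ _ _ _ (cg x _ gA) nx) => y /= gy dy.
  by rewrite leNgt dy.
- move=> A; rewrite deq lexx => fA.
  have gA : nbhs (g x) A by rewrite -fg.
  rewrite nbhs_simpl.
  apply: (@filterS2 _ (nbhs x) _ _ _ _ _ (cf x _ fA) (cg x _ gA)) => y /= fy gy.
  by case: ifP.
Qed.

(** * Delta-generated spaces *)

(** McShane's extension, for the constant 1: [G] is the graph of a 1-Lipschitz
    function on a subset of the line. *)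
Lemma lipschitz_extension (R : realType) (G : set (R * R)) : G !=set0 ->
  (forall z w, G z -> G w -> `|z.2 - w.2| <= `|z.1 - w.1|) ->
  exists2 u : R -> R, continuous u & forall z, G z -> u z.1 = z.2.
Proof.
move=> [z0 Gz0] lipG.
(* The least 1-Lipschitz extension: its value at [t] is the supremum of the
   lower bounds that the points of [G] impose. *)
pose S t := [set z.2 - `|t - z.1| | z in G].
have supS t : has_sup (S t).
  split; first by exists (z0.2 - `|t - z0.1|), z0.
  exists (z0.2 + `|t - z0.1|) => _ [z Gz <-].
  have := le_trans (ler_norm _) (lipG z z0 Gz Gz0).
  have := ler_distD t z.1 z0.1; rewrite (distrC z.1 t); lra.
have lipS s t : sup (S s) <= sup (S t) + `|s - t|.
  apply: ge_sup; first exact: (supS s).1.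
  move=> _ [z Gz <-].
  have : z.2 - `|t - z.1| <= sup (S t).
    by apply: ub_le_sup; [exact: (supS t).2|exists z].
  have := ler_distD s t z.1; rewrite (distrC t s); lra.
exists (fun t => sup (S t)) => [t|z Gz].
  apply/cvgrPdist_lt => e e0; apply/nbhs_ballP; exists e => //= s.
  rewrite /ball/=; apply: le_lt_trans.
  rewrite ler_norml; apply/andP; split.
    by have := lipS s t; rewrite (distrC s t); lra.
  by have := lipS t s; lra.
apply/eqP; rewrite eq_le; apply/andP; split.
  apply: ge_sup; first exact: (supS _).1.
  move=> _ [w Gw <-]; have := le_trans (ler_norm _) (lipG w z Gw Gz).
  rewrite (distrC w.1); lra.
apply: ub_le_sup; first exact: (supS _).2.
by exists z => //; rewrite subrr normr0 subr0.
Qed.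

Section DeltaGenerated.
Variable R : realType.

(** A sequence that converges fast enough is threaded by a path: the assignment
    of [s k] to the time [2^-k] and of the limit [x] to the time 0 is 1-Lipschitz. *)
Lemma path_through_sequence (s : nat -> I01 R) (x : I01 R) :
  (forall k, `|ival (s k) - ival x| <= 2^-1 ^+ k / 4) ->
  exists p : I01 R -> I01 R,
    [/\ continuous p, p I0 = x & forall k, p (clamp01 (2^-1 ^+ k)) = s k].
Proof.
move=> sx; pose a k : R := 2^-1 ^+ k.
have a0 k : 0 < a k by rewrite exprn_gt0// invr_gt0.
have aS k : a k.+1 = a k / 2 by rewrite /a exprSr.
have a_anti : {homo a : m n / (m <= n)%N >-> n <= m}.
  by move=> m n mn; apply: ler_wiXn2l => //; rewrite ?invr_ge0 ?invf_le1 ?ler1n.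
have a01 k : 0 <= a k <= 1.
  by rewrite ltW//=; have := a_anti _ _ (leq0n k); rewrite /a expr0.
pose G := [set z : R * R | z = (0, ival x)] `|` range (fun k => (a k, ival (s k))).
have lipG z w : G z -> G w -> `|z.2 - w.2| <= `|z.1 - w.1|.
  have sx0 k : `|ival x - ival (s k)| <= `|0 - a k|.
    rewrite distrC sub0r normrN (ger0_norm (ltW (a0 k))).
    by have := sx k; have := a0 k; rewrite -/(a k); lra.
  have sss m n : (m < n)%N -> `|ival (s m) - ival (s n)| <= `|a m - a n|.
    move=> mn; have := a_anti _ _ mn; rewrite aS => anm.
    have := ler_distD (ival x) (ival (s m)) (ival (s n)).
    rewrite (distrC (ival x)); have := sx m; have := sx n.
    have aD : 0 <= a m - a n by have := a0 m; have := a0 n; lra.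
    by rewrite -/(a m) -/(a n) (ger0_norm aD); have := a0 m; have := a0 n; lra.
  move=> [->|[m _ <-]] [->|[n _ <-]] /=; rewrite ?subrr//.
    by rewrite distrC (distrC (a m)).
  have [mn|nm|->] := ltngtP m n; [exact: sss| |by rewrite !subrr].
  by rewrite distrC (distrC (a m)); exact: sss.
have [|u cu uG] := lipschitz_extension _ lipG.
  by exists (0, ival x); left.
exists (fun t => clamp01 (u (ival t))); split=> [t||k].
- apply: (@continuous_comp _ _ _ (u \o ival) clamp01).
  2: exact: clamp01_continuous.
  by apply: continuous_comp; [exact: ival_continuous|exact: cu].
- by rewrite ival0 (uG (0, ival x)) ?ivalK//; left.
- by rewrite clamp01K// (uG (a k, ival (s k))) ?ivalK//; right; exists k.
Qed.

(** If [A] is not a neighborhood of one of its points, then this point is a fast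
    limit of points outside [A], and a path through them contradicts the
    openness of the preimages of [A]. *)
Lemma I01_square_dg : delta_generated R (I01 R * I01 R)%type.
Proof.
move=> A oA; rewrite openE => -[x y] Axy; apply: contrapT => nA.
have /choice[z zP] k : exists z : I01 R * I01 R,
    [/\ ~ A z, `|ival z.1 - ival x| <= 2^-1 ^+ k / 4 &
        `|ival z.2 - ival y| <= 2^-1 ^+ k / 4].
  apply: contrapT => nz; apply: nA.
  have near_ival (w : I01 R) : nbhs w [set v | `|ival v - ival w| <= 2^-1 ^+ k / 4].
    have nb : nbhs (ival w) [set r | `|r - ival w| <= 2^-1 ^+ k / 4].
      apply/nbhs_ballP; exists (2^-1 ^+ k / 4) => [|v] /=.
        by rewrite divr_gt0// exprn_gt0// invr_gt0.
      by rewrite /ball/= distrC => /ltW.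
    exact: (@ival_continuous R w _ nb).
  exists ([set v | `|ival v - ival x| <= 2^-1 ^+ k / 4],
          [set v | `|ival v - ival y| <= 2^-1 ^+ k / 4]) => //.
  by move=> [v w] /= [vx wy]; apply: contrapT => nAvw; apply: nz; exists (v, w).
have [|p [cp p0 pk]] := @path_through_sequence (fun k => (z k).1) x.
  by move=> k; have [] := zP k.
have [|q [cq q0 qk]] := @path_through_sequence (fun k => (z k).2) y.
  by move=> k; have [] := zP k.
have := oA (fun t => (p t, q t)); rewrite openE => /(_ _ I0)/=.
rewrite p0 q0 => /(_ (fun t => cvg_pair (cp t) (cq t)) Axy) nA0.
have : (clamp01 (2^-1 ^+ k) : I01 R) @[k --> \oo] --> (I0 : I01 R).
  apply: continuous_cvg; first exact: clamp01_continuous.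
  by apply: cvg_expr; rewrite ger0_norm ?invr_ge0// invf_lt1 ?ltr1n.
move=> /(_ _ nA0) [k _ /(_ k (leqnn k))] /=.
by rewrite pk qk -surjective_pairing; have [] := zP k.
Qed.

(** The tube lemma reduces this to the square of [0, 1]. *)
Lemma prod_I01_dg (T : topologicalType) :
  delta_generated R T -> delta_generated R (T * I01 R)%type.
Proof.
move=> dgT A oA; rewrite openE => -[x t] Axt.
have opair (p : I01 R -> T) : continuous p ->
    open [set z : I01 R * I01 R | A (p z.1, z.2)].
  move=> cp; apply: I01_square_dg => q cq.
  apply: (oA (fun s => (p (q s).1, (q s).2))); apply: cts_pair.
    by apply: cts_comp cp; apply: cts_comp cq _; exact: cts_fst.
  by apply: cts_comp cq _; exact: cts_snd.
have ot : nbhs t [set s | A (x, s)].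
  apply: open_nbhs_nbhs; split=> //.
  apply: (oA (pair x)); apply: cts_pair; last exact: id_cts.
  exact: cst_continuous.
have regI : regular_space (I01 R).
  move=> s; apply: compact_regular; first exact: I01_hausdorff.
      exact: I01_compact.
    exact: filterT.
have [J nJ JA] := regI t _ ot.
have cJ : compact (closure J).
  by apply: (subclosed_compact _ (@I01_compact R)); [exact: closed_closure|].
have oV : open [set y | closure J `<=` [set s | A (y, s)]].
  apply: dgT => p cp; rewrite openE => r rJ.
  move/compact_near_coveringP : cJ => cJ.
  apply: (cJ _ (nbhs r) (fun y s => A (p y, s))) => s Js.
  have : nbhs (r, s) [set z : I01 R * I01 R | A (p z.1, z.2)].
    by apply: open_nbhs_nbhs; split; [exact: opair|exact: rJ].
  move=> [[B C] [/= Br Cs] BC]; exists (C, B) => //= -[c b] [/= Cc Bb].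
  exact: (BC (b, c)).
exists ([set y | closure J `<=` [set s | A (y, s)]], J).
  by split=> //; apply: open_nbhs_nbhs.
by move=> [y s] /= [yJ Js]; apply: yJ; exact: subset_closure.
Qed.

Lemma kelley_id_continuous (T : topologicalType) :
  continuous (id : kelley R T -> T).
Proof.
apply/continuousP => A oA; rewrite kelley_openE => p /continuousP; exact.
Qed.

Lemma continuous_kelley (Z T : topologicalType) (f : Z -> T) :
  delta_generated R Z -> continuous f -> continuous (f : Z -> kelley R T).
Proof.
move=> dgZ cf; apply/continuousP => A oA; apply: dgZ => p cp.
by apply: (oA (f \o p)) => t; apply: continuous_comp; [exact: cp|exact: cf].
Qed.

Lemma kelley_dg (T : topologicalType) : delta_generated R (kelley R T).
Proof.
move=> A oA; rewrite kelley_openE => p cp; apply: oA.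
by apply: continuous_kelley => //; exact: I01_dg.
Qed.

End DeltaGenerated.

(** * Spaces of execution paths *)

Section PathSpace.
Variables (R : realType) (P : reparam_cat) (X : mdspace R P).

(** The execution path underlying a point of [Ptop X]. *)
Definition path_fun (g : Ptop X) : I01 R -> X :=
  mapping_fun (set_val (projT2 g : set_type (path_set _ _))).

Lemma path_fun_paths g : paths X (path_fun g).
Proof. by have [] := set_valP (projT2 g : set_type (path_set _ _)). Qed.

Lemma path_fun_inj : injective path_fun.
Proof.
move=> [[u v] g] [[u' v'] g'] gg'.
have [/= pg g0 g1] := set_valP (g : set_type (path_set _ _)).
have [/= pg' g0' g1'] := set_valP (g' : set_type (path_set _ _)).
rewrite /path_fun /= in gg'.
have uu' : u = u' by apply: val_inj; rewrite [LHS](esym g0) [RHS](esym g0') gg'.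
have vv' : v = v' by apply: val_inj; rewrite [LHS](esym g1) [RHS](esym g1') gg'.
subst u' v'; congr existT; apply: val_inj => /=.
by apply/continuousEP => t; exact: (congr1 (@^~ t) gg').
Qed.

Lemma Ptop_dg : delta_generated R (Ptop X).
Proof.
move=> A oA; apply/sigT_openP => uv; apply: kelley_dg => p cp.
apply: (oA (fun t => existT _ uv (p t))).
exact: (cts_comp cp (@existT_continuous _ _ uv)).
Qed.

(** Evaluation is continuous because [0, 1] is locally compact. *)
Lemma path_fun_continuous :
  continuous (fun z : Ptop X * I01 R => path_fun z.1 z.2).
Proof.
have cf : continuous (path_fun : Ptop X -> {compact-open, I01 R -> X}).
  apply/continuousP => A oA; apply/sigT_openP => uv.
  have : continuous (fun g : path_space (set_val uv.1) (set_val uv.2) =>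
      (mapping_fun (set_val (g : set_type (path_set _ _)))
        : {compact-open, I01 R -> X})).
    have c1 : continuous (id : path_space (set_val uv.1) (set_val uv.2) ->
        set_type (path_set (set_val uv.1) (set_val uv.2))).
      exact: kelley_id_continuous.
    have c2 : continuous
        (@set_val _ (path_set (set_val uv.1) (set_val uv.2))).
      exact: initial_continuous.
    have c3 : continuous (id : mapping_space R (I01 R) X -> initial_topology
        (id : continuousType (I01 R) X -> {compact-open, I01 R -> X})).
      exact: kelley_id_continuous.
    have c4 : continuous (id : initial_topology
        (id : continuousType (I01 R) X -> {compact-open, I01 R -> X}) ->
        {compact-open, I01 R -> X}).
      exact: initial_continuous.
    exact: (cts_comp (cts_comp (cts_comp c1 c2) c3) c4).
  by move=> /continuousP; apply.
have -> : (fun z => path_fun z.1 z.2) = uncurry path_fun by apply/funext => -[].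
apply: continuous_uncurry cf _; last first.
- by move=> g; apply: paths_cts; exact: path_fun_paths.
- exact: I01_hausdorff.
- move=> t _; exists setT; first by rewrite withinET; exact: filterT.
  by split; [exact: I01_compact|exact: closedT].
Qed.

(** All the paths [F z] have the same endpoints, so that they lie in a single
    summand of [Ptop X]. *)
Lemma Ptop_lift (Z : topologicalType) (F : Z -> I01 R -> X) (u v : X) :
  delta_generated R Z -> continuous (fun z : Z * I01 R => F z.1 z.2) ->
  (forall z, paths X (F z)) -> (forall z, F z I0 = u) ->
  (forall z, F z I1 = v) ->
  states X u -> states X v ->
  exists2 Phi : Z -> Ptop X, continuous Phi & forall z, path_fun (Phi z) = F z.
Proof.
move=> dgZ cF pF F0 F1 su sv.
have cFz z : continuous (F z) by apply: paths_cts.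
pose G z : mapping_space R (I01 R) X := (mkcts (cFz z) : continuousType (I01 R) X).
have GP z : path_set u v (G z) by split; [exact: pF|exact: F0|exact: F1].
pose uv := (set_elt su, set_elt sv).
pose H z : path_space (set_val uv.1) (set_val uv.2) := set_elt (GP z).
have cH : continuous H.
  have cG : continuous G.
    apply: (@continuous_kelley R Z (initial_topology
      (id : continuousType (I01 R) X -> {compact-open, I01 R -> X})) G dgZ).
    apply: continuous_comp_initial.
    exact: (continuous_curry_fun cF).
  apply: (@continuous_kelley R Z (set_type (path_set u v)) H dgZ).
  by apply: continuous_comp_initial; exact: cG.
exists (fun z => existT _ uv (H z)) => //.
exact: (cts_comp cH (@existT_continuous _ _ uv)).
Qed.

End PathSpace.

(** * The map s is a weak equivalence *)

Lemma deformation_retract_weak_equivalence (R : realType)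
    (T U : topologicalType) (f : continuousType T U) (r : U -> T)
    (K : U * I01 R -> U) :
  continuous r -> continuous K -> cancel f r ->
  (forall y, K (y, I0) = f (r y)) -> (forall y, K (y, I1) = y) ->
  (forall x t, K (f x, t) = f x) -> weak_homotopy_equivalence R f.
Proof.
move=> cr cK fK K0 K1 Kf; split.
  split=> [x y [p [cp p0 p1]]|y].
    exists (r \o p); split; first exact: (cts_comp cp cr).
    - by rewrite /= p0 fK.
    - by rewrite /= p1 fK.
  exists (r y), (fun t => K (y, t)); split=> //.
  apply: cts_comp cK; apply: cts_pair; [exact: cst_continuous|exact: id_cts].
move=> n x _; split=> [a b [ca ax] [cb bx] [H [cH H0 H1 Hbd]]|c [cc cx]].
  exists (r \o H); split=> [|z|z|z t bz] /=.
  - exact: (cts_comp cH cr).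
  - by rewrite H0 /= fK.
  - by rewrite H1 /= fK.
  - by rewrite Hbd//= fK.
exists (r \o c).
  by split=> [|z bz] /=; [exact: (cts_comp cc cr)|rewrite cx// fK].
exists (fun z => K (c z.1, z.2)); split=> [|z|z|z t bz] /=.
- apply: cts_comp cK; apply: cts_pair; last exact: cts_snd.
  by apply: cts_comp cc; exact: cts_fst.
- exact: K0.
- exact: K1.
- by rewrite cx// Kf fK.
Qed.

Section Height.
Variable R : realType.
Implicit Types (g : I01 R -> I01 R) (c : R).

Lemma height_has_sup g : has_sup (range (ival \o g)).
Proof.
split; first by exists (ival (g I0)), I0.
by exists 1 => _ [t _ <-] /=; have /andP[] := ival01 (g t).
Qed.

Lemma le_height g t : ival (g t) <= height g.
Proof. by apply: ub_le_sup; [exact: (height_has_sup g).2|exists t]. Qed.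

Lemma height_le g c : (forall t, ival (g t) <= c) -> height g <= c.
Proof.
move=> gc; apply: ge_sup; first exact: (height_has_sup g).1.
by move=> _ [t _ <-]; exact: gc.
Qed.

Lemma height_gt g c : c < height g -> exists t, c < ival (g t).
Proof.
move=> cg; apply: contrapT => nt; move: cg; apply/negP; rewrite -leNgt.
by apply: height_le => t; rewrite leNgt; apply/negP => ct; apply: nt; exists t.
Qed.

Lemma height_le1 g : height g <= 1.
Proof. by apply: height_le => t; have /andP[] := ival01 (g t). Qed.

Lemma height_gt0 g : loops_nonzero g -> 0 < height g.
Proof.
move=> [_ g0]; rewrite ltNge; apply/negP => hg; apply: g0; apply/funext => t.
apply: ival_inj; apply/eqP; rewrite eq_le ival0 (le_trans (le_height g t) hg)/=.
by have /andP[] := ival01 (g t).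
Qed.

(** The maximum over a compact factor depends continuously on the parameter. *)
Lemma height_continuous (Z : topologicalType) (F : Z -> I01 R -> I01 R) :
  continuous (fun z : Z * I01 R => F z.1 z.2) ->
  continuous (fun z => height (F z)).
Proof.
move=> cF z; apply/cvgrPdist_lt => e e0.
have civF : continuous (fun w : Z * I01 R => ival (F w.1 w.2)).
  exact: (cts_comp cF (@ival_continuous R)).
have nearF t (A : set R) : nbhs (ival (F z t)) A ->
    nbhs (z, t) [set w : Z * I01 R | A (ival (F w.1 w.2))].
  exact: (civF (z, t)).
have [t zt] : exists t, height (F z) - e < ival (F z t).
  by apply: height_gt; lra.
have lower : \forall w \near z, height (F z) - e < height (F w).
  have [[B C] [/= Bz Ct] BC] := nearF t _ (lt_nbhsr zt).
  apply: filterS Bz => w Bw; apply: lt_le_trans (le_height (F w) t).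
  by apply: (BC (w, t)); split=> //; exact: nbhs_singleton.
have upper : \forall w \near z, height (F w) < height (F z) + e.
  have /compact_near_coveringP cI := @I01_compact R.
  have : \forall w \near z, [set: I01 R] `<=`
      [set t | ival (F w t) < height (F z) + e / 2].
    apply: (cI _ _ (fun w t => ival (F w t) < height (F z) + e / 2)) => s _.
    have : ival (F z s) < height (F z) + e / 2.
      by have := le_height (F z) s; lra.
    move=> /lt_nbhsl /nearF [[B C] [/= Bz Cs] BC].
    by exists (C, B) => // -[c b] [/= Cc Bb]; exact: (BC (b, c)).
  apply: filterS => w wlt.
  apply: (@le_lt_trans _ _ (height (F z) + e / 2)); last lra.
  by apply: height_le => s; apply: ltW; exact: wlt.
near=> w; rewrite ltr_norml; apply/andP; split.
  have : height (F w) < height (F z) + e by near: w.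
  lra.
have : height (F z) - e < height (F w) by near: w.
lra.
Unshelve. all: by end_near. Qed.

(** The loop [c g]; the value of [clamp01] is the product itself as soon as
    [c * height g <= 1]: see [rescaleE]. *)
Definition rescale c g : I01 R -> I01 R := fun t => clamp01 (c * ival (g t)).

Lemma rescaleE c g t :
  0 <= c -> c * height g <= 1 -> ival (rescale c g t) = c * ival (g t).
Proof.
move=> c0 cg; rewrite clamp01K//; have /andP[g0 _] := ival01 (g t).
by rewrite mulr_ge0//= (le_trans _ cg)// ler_wpM2l// le_height.
Qed.

Lemma rescale1 g : rescale 1 g = g.
Proof. by apply/funext => t; rewrite /rescale mul1r ivalK. Qed.

Lemma rescale_height c g :
  0 < c -> c * height g <= 1 -> height (rescale c g) = c * height g.
Proof.
move=> c0 cg; apply/eqP; rewrite eq_le; apply/andP; split.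
  apply: height_le => t; rewrite rescaleE ?(ltW c0)//.
  by rewrite ler_wpM2l ?le_height ?(ltW c0).
rewrite mulrC -ler_pdivlMr//; apply: height_le => t.
by rewrite ler_pdivlMr// mulrC -rescaleE ?(ltW c0)// le_height.
Qed.

Lemma rescale_continuous (Z : topologicalType) (F : Z -> I01 R -> I01 R)
    (c : Z -> R) :
  continuous (fun z : Z * I01 R => F z.1 z.2) -> continuous c ->
  continuous (fun z : Z * I01 R => rescale (c z.1) (F z.1) z.2).
Proof.
move=> cF cc; apply: cts_comp (@clamp01_continuous R); apply: cts_mul.
  by apply: cts_comp cc; exact: cts_fst.
exact: (cts_comp cF (@ival_continuous R)).
Qed.

Lemma rescale_loops c g : loops g -> loops (rescale c g).
Proof.
move=> [cg g0 g1]; split; rewrite /rescale ?g0 ?g1 ?ival0 ?mulr0//.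
apply: cts_comp (@clamp01_continuous R); apply: cts_mul.
  exact: cst_continuous.
exact: (cts_comp cg (@ival_continuous R)).
Qed.

Lemma loops_nonzero_height g : loops g -> 0 < height g -> loops_nonzero g.
Proof.
move=> lg hg; split=> // g0; move: hg; apply/negP; rewrite -leNgt.
by apply: height_le => t; rewrite g0 /= ival0.
Qed.

End Height.

Lemma map_s_weak_equivalence (R : realType) (P : reparam_cat) :
  weak_equivalence (map_s R P).
Proof.
split.
  by split=> // x ->; exists I0.
pose A := spaceA R P; pose B := spaceB R P.
pose h (y : Ptop B) := height (path_fun y).
have lB (y : Ptop B) : loops_nonzero (path_fun y) by exact: (path_fun_paths y).
have h0 y : 0 < h y by exact: height_gt0.
have hN0 y : h y != 0 by rewrite gt_eqF.
have ch : continuous h.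
  by apply: (height_continuous (F := @path_fun R P B)); exact: path_fun_continuous.
have [|||||||r cr rE] := @Ptop_lift R P A (Ptop B)
  (fun y => rescale (h y)^-1 (path_fun y)) I0 I0.
- exact: Ptop_dg.
- apply: (@rescale_continuous R (Ptop B) (@path_fun R P B) (fun y => (h y)^-1)).
    exact: path_fun_continuous.
  exact: (cts_inv hN0 ch).
- move=> y; split; first by apply: rescale_loops; have [] := lB y.
  by rewrite rescale_height ?invr_gt0 // mulVf.
- by move=> y; have [[_ y0 _] _] := lB y; rewrite /rescale y0 ival0 mulr0.
- by move=> y; have [[_ _ y1] _] := lB y; rewrite /rescale y1 ival0 mulr0.
- by [].
- by [].
(* The factor moves linearly from [1 / height] to 1, so that the homotopy goes
   from the normalized loop to the loop itself and is stationary at height 1. *)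
pose c (z : Ptop B * I01 R) := (1 - ival z.2) / h z.1 + ival z.2.
have c0 z : 0 < c z.
  have /andP[t0 t1] := ival01 z.2; have h1 : h z.1 <= 1 by exact: height_le1.
  have : 1 <= (h z.1)^-1 by rewrite invf_ge1.
  by rewrite /c; nra.
have ch1 z : c z * h z.1 <= 1.
  have /andP[t0 t1] := ival01 z.2; have h1 : h z.1 <= 1 by exact: height_le1.
  by rewrite /c mulrDl divfK//; nra.
have [|||||||K cK KE] := @Ptop_lift R P B (Ptop B * I01 R)%type
  (fun z => rescale (c z) (path_fun z.1)) I0 I0.
- by apply: prod_I01_dg; exact: Ptop_dg.
- apply: (@rescale_continuous R (Ptop B * I01 R)%type
    (fun z => @path_fun R P B z.1) c).
    apply: (@cts_comp _ (Ptop B * I01 R)%type _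
      (fun z => (z.1.1, z.2)) (fun z => path_fun z.1 z.2)).
      apply: cts_pair; last exact: cts_snd.
      by apply: (cts_comp (@cts_fst _ _)); exact: cts_fst.
    exact: path_fun_continuous.
  have ct : continuous (fun z : Ptop B * I01 R => ival z.2).
    by apply: (cts_comp (@cts_snd _ _)); exact: ival_continuous.
  apply: (cts_add _ ct); apply: cts_mul.
    by apply: (cts_sub _ ct); exact: cst_continuous.
  apply: cts_inv => [w|]; first exact: hN0.
  by apply: cts_comp ch; exact: cts_fst.
- move=> z; apply: loops_nonzero_height.
    by apply: rescale_loops; have [] := lB z.1.
  by rewrite (rescale_height (c0 z) (ch1 z)); exact: mulr_gt0 (c0 z) (h0 z.1).
- by move=> y; have [[_ y0 _] _] := lB y.1; rewrite /rescale y0 ival0 mulr0.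
- by move=> y; have [[_ _ y1] _] := lB y.1; rewrite /rescale y1 ival0 mulr0.
- by [].
- by [].
have fE (x : Ptop A) : path_fun (Ptop_cts (map_s R P) x) = path_fun x by [].
have hA (x : Ptop A) : h (Ptop_cts (map_s R P) x) = 1.
  by have [] : loops_full (path_fun x) by exact: (path_fun_paths x).
apply: (deformation_retract_weak_equivalence cr cK) => [x|y|y|x t];
  apply: path_fun_inj.
- by rewrite rE hA invr1 rescale1.
- by rewrite KE fE rE /c /= ival0 subr0 mul1r addr0.
- by rewrite KE /c /= ival1 subrr mul0r add0r rescale1.
- by rewrite KE /c /= hA divr1 subrK rescale1.
Qed.

(** * Shrinking a loop to nothing *)

Section Squeeze.
Variable R : realType.
Implicit Types t s u : R.

(** The piecewise linear homeomorphism of [0, 1] that maps [0, t / 2] onto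
    [0, 1 / 2] and [t / 2, 1] onto [1 / 2, 1]. For [t <= 1] it is concave, whence
    a minimum of two affine functions. *)
Definition squeeze t s : R := Num.min (s / t) ((1 + (2 * s - t) / (2 - t)) / 2).

(** The inverse of [squeeze t], which is convex. *)
Definition unsqueeze t u : R :=
  Num.max (t * u) (((2 * u - 1) * (2 - t) + t) / 2).

Lemma squeeze_lo t s : 0 < t <= 1 -> s <= t / 2 -> squeeze t s = s / t.
Proof.
move=> /andP[t0 t1] st; rewrite /squeeze min_l//.
have d0 : 0 < 2 - t by lra.
have : (2 * s - t) / (2 - t) * (2 - t) = 2 * s - t by rewrite divfK// gt_eqF.
have : s / t * t = s by rewrite divfK// gt_eqF.
have : s / t <= 2^-1 by rewrite ler_pdivrMr//; lra.
set q := _ / (2 - t); set p := s / t => p2 pE qE.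
have : 0 <= (1 - t) * (2^-1 - p) by rewrite mulr_ge0//; lra.
nra.
Qed.

Lemma squeeze_hi t s : 0 < t <= 1 -> t / 2 <= s ->
  squeeze t s = (1 + (2 * s - t) / (2 - t)) / 2.
Proof.
move=> /andP[t0 t1] st; rewrite /squeeze min_r// ler_pdivlMr//.
have d0 : 0 < 2 - t by lra.
have : (2 * s - t) / (2 - t) * (2 - t) = 2 * s - t by rewrite divfK// gt_eqF.
set q := _ / (2 - t); nra.
Qed.

Lemma unsqueeze_lo t u : 0 < t <= 1 -> u <= 2^-1 -> unsqueeze t u = t * u.
Proof. by move=> /andP[t0 t1] u2; rewrite /unsqueeze max_l//; nra. Qed.

Lemma unsqueeze_hi t u : 0 < t <= 1 -> 2^-1 <= u ->
  unsqueeze t u = ((2 * u - 1) * (2 - t) + t) / 2.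
Proof. by move=> /andP[t0 t1] u2; rewrite /unsqueeze max_r//; nra. Qed.

Lemma squeeze01 t s : 0 < t <= 1 -> 0 <= s <= 1 -> 0 <= squeeze t s <= 1.
Proof.
move=> t01 /andP[s0 s1]; have /andP[t0 t1] := t01.
have [st|ts] := leP s (t / 2).
  rewrite squeeze_lo// divr_ge0 ?(ltW t0)//= ler_pdivrMr//; lra.
rewrite squeeze_hi ?(ltW ts)//.
have d0 : 0 < 2 - t by lra.
have : (2 * s - t) / (2 - t) * (2 - t) = 2 * s - t by rewrite divfK// gt_eqF.
set q := _ / (2 - t) => qE; apply/andP; split; nra.
Qed.

Lemma unsqueeze01 t u : 0 < t <= 1 -> 0 <= u <= 1 -> 0 <= unsqueeze t u <= 1.
Proof.
move=> t01 /andP[u0 u1]; have /andP[t0 t1] := t01.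
have [ut|tu] := leP u 2^-1.
  by rewrite unsqueeze_lo//; nra.
by rewrite unsqueeze_hi ?(ltW tu)//; nra.
Qed.

Lemma squeezeK t s : 0 < t <= 1 -> unsqueeze t (squeeze t s) = s.
Proof.
move=> t01; have /andP[t0 t1] := t01; have [st|ts] := leP s (t / 2).
  rewrite squeeze_lo// unsqueeze_lo//; first by rewrite mulrC divfK// gt_eqF.
  by rewrite ler_pdivrMr// mulrC.
rewrite squeeze_hi ?(ltW ts)//.
have d0 : 0 < 2 - t by lra.
have : (2 * s - t) / (2 - t) * (2 - t) = 2 * s - t by rewrite divfK// gt_eqF.
by set q := _ / (2 - t) => qE; rewrite unsqueeze_hi//; nra.
Qed.

Lemma unsqueezeK t u : 0 < t <= 1 -> squeeze t (unsqueeze t u) = u.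
Proof.
move=> t01; have /andP[t0 t1] := t01; have [ut|tu] := leP u 2^-1.
  rewrite unsqueeze_lo// squeeze_lo//; first by rewrite mulrC mulKf// gt_eqF.
  by rewrite ler_pM2l.
rewrite unsqueeze_hi ?(ltW tu)// squeeze_hi//; last by nra.
rewrite mulrCA divff// mulr1 addrK mulfK; last by rewrite gt_eqF//; lra.
lra.
Qed.

Lemma squeeze_homo t s s' : 0 < t <= 1 -> s <= s' -> squeeze t s <= squeeze t s'.
Proof.
move=> /andP[t0 t1] ss; rewrite le_min !ge_min ler_pM2r ?invr_gt0// ss/=.
apply/orP; right; rewrite ler_pM2r ?invr_gt0// lerD2l ler_pM2r ?invr_gt0//; lra.
Qed.

Definition squeeze_reparam t (s : I01 R) : I01 R := clamp01 (squeeze t (ival s)).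

Lemma squeeze_reparamE t (s : I01 R) : 0 < t <= 1 ->
  ival (squeeze_reparam t s) = squeeze t (ival s).
Proof. by move=> t01; rewrite clamp01K// squeeze01// ival01. Qed.

Lemma reparam_squeeze (P : reparam_cat) t : 0 < t <= 1 ->
  reparam P (squeeze_reparam t).
Proof.
move=> t01.
have homo : {homo squeeze_reparam t : x y / ival x <= ival y}.
  by move=> s s' ss; rewrite !squeeze_reparamE// squeeze_homo.
pose psi (u : I01 R) : I01 R := clamp01 (unsqueeze t (ival u)).
have K1 : cancel (squeeze_reparam t) psi.
  by move=> s; rewrite /psi squeeze_reparamE// squeezeK// ivalK.
have K2 : cancel psi (squeeze_reparam t).
  move=> u; rewrite /psi /squeeze_reparam clamp01K ?unsqueeze01 ?ival01//.
  by rewrite unsqueezeK// ivalK.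
case: P; last by split=> // u _; exists (psi u).
have civ := @ival_continuous R.
have ccst (a : R) : continuous (fun _ : I01 R => a) by exact: cst_continuous.
split=> //.
  apply: (cts_comp _ (@clamp01_continuous R)); apply: cts_min.
    exact: (cts_mul civ (ccst _)).
  apply: (cts_mul _ (ccst _)); apply: (cts_add (ccst _)).
  apply: (cts_mul _ (ccst _)); apply: (cts_sub _ (ccst _)).
  exact: (cts_mul (ccst _) civ).
exists psi; split=> //.
apply: (cts_comp _ (@clamp01_continuous R)); apply: cts_max.
  exact: (cts_mul (ccst _) civ).
apply: (cts_mul _ (ccst _)); apply: (cts_add _ (ccst _)).
apply: (cts_mul _ (ccst _)); apply: (cts_sub _ (ccst _)).
exact: (cts_mul (ccst _) civ).
Qed.

End Squeeze.

Section Tent.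
Variable R : realType.

(** The loop that rises linearly from 0 to 1 and goes down again. *)
Definition tent : I01 R -> I01 R := fun t => clamp01 (1 - `|2 * ival t - 1|).

Lemma tentE t : ival (tent t) = 1 - `|2 * ival t - 1|.
Proof.
rewrite clamp01K// subr_ge0 lerBlDr lerDl normr_ge0 andbT ler_norml.
have := ival01 t; lra.
Qed.

Lemma loops_full_tent : loops_full tent.
Proof.
split; first split.
- apply: (cts_comp _ (@clamp01_continuous R)); apply: cts_sub.
    exact: cst_continuous.
  apply: cts_norm; apply: cts_sub; last exact: cst_continuous.
  by apply: cts_mul; [exact: cst_continuous|exact: ival_continuous].
- by apply: ival_inj; rewrite tentE ival0 mulr0 sub0r normrN normr1 subrr.
- apply: ival_inj; rewrite tentE ival0 ival1 mulr1.
  by rewrite (_ : 2 - 1 = 1) ?normr1 ?subrr//; lra.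
apply/eqP; rewrite eq_le height_le1/=.
apply: le_trans (le_height _ (clamp01 2^-1)).
rewrite tentE clamp01K; last by apply/andP; split; lra.
by rewrite divff// subrr normr0 subr0.
Qed.

End Tent.

(** An execution path [c] that starts and ends at the base point of [B] is
    joined to its composition with a loop of [B] put before it. *)
Lemma shrinking_path (R : realType) (P : reparam_cat) (Y : mdspace R P)
    (l : mdmap (spaceB R P) Y) (c : I01 R -> Y) :
  paths Y c -> c I0 = l I0 -> c I1 = l I0 ->
  exists p : I01 R -> Ptop Y,
    [/\ continuous p, path_fun (p I0) = c
      & path_fun (p I1) = norm_comp (l \o @tent R) c].
Proof.
move=> pc cI0 cI1.
(* The tent of height [t], run through on [0, t / 2], followed by [c]. The
   argument [t - |4 s - t|] is [t * tent (2 s / t)], without the division by [t]. *)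
pose H (t s : I01 R) : Y := if ival s - ival t / 2 <= 0
  then l (clamp01 (ival t - `|4 * ival s - ival t|))
  else c (clamp01 ((2 * ival s - ival t) / (2 - ival t))).
have d0 (t : I01 R) : 0 < 2 - ival t by have := ival01 t; lra.
have H0 : H I0 = c.
  apply/funext => s; rewrite /H ival0 mul0r !subr0 mulrAC divff// mul1r.
  have [s0|s0] := leP (ival s) 0; last by rewrite ivalK.
  have -> : s = I0.
    by apply: ival_inj; rewrite ival0; have := ival01 s; lra.
  by rewrite cI0 ival0 mulr0 normr0 subr0.
(* For [t > 0], [H t] is a reparametrized normalized composition. *)
have HE (t : I01 R) : 0 < ival t ->
    H t = norm_comp (l \o rescale (ival t) (@tent R)) c \o
            squeeze_reparam (ival t).
  move=> t0; have t01 : 0 < ival t <= 1 by rewrite t0; have /andP[] := ival01 t.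
  apply/funext => s; rewrite /H /= /norm_comp squeeze_reparamE//.
  have [st|ts] := leP (ival s) (ival t / 2).
    have p2 : ival s / ival t <= 2^-1 by rewrite ler_pdivrMr//; lra.
    rewrite subr_le0 st squeeze_lo// p2.
    congr (l (clamp01 _)).
    rewrite tentE clamp01K; last first.
      apply/andP; split; last by rewrite mulrA ler_pdivrMr//; lra.
      by rewrite mulr_ge0// divr_ge0 ?(ltW t0)//; have /andP[] := ival01 s.
    rewrite mulrBr mulr1 -[X in _ = _ - X * _](ger0_norm (ltW t0)) -normrM.
    have : ival s / ival t * ival t = ival s by rewrite divfK// gt_eqF.
    by set p := _ / _ => pE; congr (_ - `|_|); nra.
  have := ts; rewrite -subr_gt0 => /lt_geF ->; rewrite squeeze_hi ?(ltW ts)//.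
  have q0 : 0 < (2 * ival s - ival t) / (2 - ival t).
    by rewrite divr_gt0//; lra.
  set q := _ / _ in q0 *; rewrite ifF; last by apply/negbTE; rewrite -ltNge; lra.
  by congr (c (clamp01 _)); lra.
have cl : continuous l by exact: mdfun_cts.
have cc : continuous c by exact: paths_cts.
have ct : continuous (fun z : I01 R * I01 R => ival z.1).
  by apply: (cts_comp (@cts_fst _ _)); exact: ival_continuous.
have cs : continuous (fun z : I01 R * I01 R => ival z.2).
  by apply: (cts_comp (@cts_snd _ _)); exact: ival_continuous.
have ccst (a : R) : continuous (fun _ : I01 R * I01 R => a).
  exact: cst_continuous.
have clc := @clamp01_continuous R.
have [|||||||p cp pE] := @Ptop_lift R P Y (I01 R) H (l I0) (l I0).
- exact: I01_dg.
- apply: (@paste_continuous R (I01 R * I01 R)%type Y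
    (fun z => ival z.2 - ival z.1 / 2)).
  + exact: (cts_sub cs (cts_mul ct (ccst _))).
  + apply: (cts_comp _ cl); apply: (cts_comp _ clc); apply: (cts_sub ct).
    exact: (cts_norm (cts_sub (cts_mul (ccst _) cs) ct)).
  + apply: (cts_comp _ cc); apply: (cts_comp _ clc); apply: cts_mul.
      exact: (cts_sub (cts_mul (ccst _) cs) ct).
    apply: cts_inv => [z|]; first by rewrite gt_eqF.
    exact: (cts_sub (ccst _) ct).
  + move=> [t s] /= st.
    have -> : 2 * ival s - ival t = 0 by lra.
    have -> : 4 * ival s - ival t = ival t by lra.
    have /andP[/ger0_norm -> _] := ival01 t.
    by rewrite subrr mul0r cI0.
- move=> t; have [t0|t0] := ltP 0 (ival t); last first.
    have -> : t = I0 by apply: ival_inj; rewrite ival0; have := ival01 t; lra.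
    by rewrite H0.
  rewrite HE//; apply: paths_reparam; last first.
    by apply: reparam_squeeze; rewrite t0; have /andP[] := ival01 t.
  have [lT hT] := loops_full_tent R.
  have t1 : ival t * height (@tent R) <= 1.
    by rewrite hT mulr1; have /andP[] := ival01 t.
  apply: paths_comp => //; last first.
    by rewrite /= cI0; have [_ _ ->] := rescale_loops (ival t) lT.
  apply: mdfun_paths; apply: loops_nonzero_height; first exact: rescale_loops.
  by rewrite rescale_height// hT mulr1.
- move=> t; rewrite /H ival0 ifT; last first.
    by rewrite sub0r oppr_le0 divr_ge0//; have /andP[] := ival01 t.
  rewrite mulr0 sub0r normrN.
  by have /andP[/ger0_norm -> _] := ival01 t; rewrite subrr.
- move=> t; rewrite /H ival1 ifF; last first.
    by apply/negbTE; rewrite -ltNge; have := d0 t; lra.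
  by rewrite mulr1 divff ?gt_eqF.
- by apply: mdfun_states.
- by apply: mdfun_states.
exists p; split=> //; first by rewrite pE.
rewrite pE HE ?ival1// rescale1; apply/funext => s /=; congr (norm_comp _ _ _).
apply: ival_inj; rewrite squeeze_reparamE ?lexx ?ltr01//.
have E : 2 - 1 = 1 :> R by lra.
by rewrite /squeeze E !divr1 (_ : (1 + _) / 2 = ival s) ?minxx//; lra.
Qed.

(** * Pushouts and lifting properties *)

Section Category.
Variables (R : realType) (P : reparam_cat).
Implicit Types A B X Y Z : mdspace R P.

Definition mdcomp X Y Z (g : mdmap Y Z) (f : mdmap X Y) : mdmap X Z :=
  @MDMap R P X Z (g \o f) (cts_comp (@mdfun_cts _ _ _ _ f) (@mdfun_cts _ _ _ _ g))
    (fun u su => mdfun_states g (mdfun_states f su))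
    (fun h ph => mdfun_paths g (mdfun_paths f ph)).

(** Maps out of a pushout are determined by their restrictions. *)
Lemma pushout_map_ext A B X Y Z (f : mdmap A B) (g : mdmap A X)
    (f' : mdmap X Y) (g' : mdmap B Y) (h h' : mdmap Y Z) :
  is_pushout f g f' g' -> h \o f' =1 h' \o f' -> h \o g' =1 h' \o g' -> h =1 h'.
Proof.
move=> [fg univ] hf hg.
have [|k [_ _ kE]] := univ Z (mdcomp h f') (mdcomp h g').
  by move=> x /=; congr (h _); exact: fg.
have hk : h =1 k by exact: kE.
have h'k : h' =1 k by apply: kE => x; [exact: esym (hf x)|exact: esym (hg x)].
by move=> y; rewrite hk h'k.
Qed.

Lemma pushout_qcofibration A B X Y (f : mdmap A B) (g : mdmap A X)
    (f' : mdmap X Y) (g' : mdmap B Y) :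
  generating_qcofibration f -> is_pushout f g f' g' -> qcofibration f'.
Proof.
move=> gf po X' Y' p llpp u v uv; have [fg univ] := po.
have [|h hf hp] := llpp _ _ f gf (mdcomp u g) (mdcomp v g').
  by move=> x /=; rewrite -[LHS]/((p \o u) (g x)) uv /=; congr (v _); exact: fg.
have [|k [kf kg _]] := univ X' u h; first by move=> x; exact: esym (hf x).
exists k => // y.
apply: (pushout_map_ext (h := mdcomp p k) (h' := v) po) => x /=.
  by rewrite -[k _]/((k \o f') x) kf; exact: uv.
by rewrite -[k _]/((k \o g') x) kg; exact: hp.
Qed.

Lemma reparam_id : reparam P (id : I01 R -> I01 R).
Proof.
case: P => /=; last by split=> // x _; exists x.
by split; [|exact: id_cts|exists id; split=> //; exact: id_cts].
Qed.

End Category.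

(** * The space of loops of height 0 or 1 *)

Section Collapse.
Variables (R : realType) (P : reparam_cat).
Implicit Types (g x y : I01 R -> I01 R).

Lemma height_reparam g phi : reparam P phi -> height (g \o phi) = height g.
Proof.
move=> phiP; rewrite /height; congr sup; apply/seteqP; split=> _ [t _ <-] /=.
  by exists (phi t).
by have [s <-] := reparam_surj phiP t; exists s.
Qed.

Lemma height_norm_comp x y : x I1 = y I0 ->
  height (norm_comp x y) = Num.max (height x) (height y).
Proof.
move=> xy; apply/eqP; rewrite eq_le ge_max; apply/and3P; split.
- apply: height_le => t; rewrite /norm_comp le_max.
  by case: ifP => _; rewrite le_height ?orbT.
- apply: height_le => t.
  have [s _ <-] : range (norm_comp x y) (x t) by apply: range_norm_comp; exists t.
  exact: le_height.
- apply: height_le => t; have := ival01 t => t01.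
  have E : ival (clamp01 ((1 + ival t) / 2)) = (1 + ival t) / 2.
    by rewrite clamp01K//; lra.
  suff <- : norm_comp x y (clamp01 ((1 + ival t) / 2)) = y t by exact: le_height.
  rewrite /norm_comp E; case: ifP => [h|_].
    have t0 : ival t = 0 by lra.
    rewrite (_ : 2 * _ = 1); last lra.
    by rewrite -/I1 xy; congr y; apply: ival_inj; rewrite ival0.
  by rewrite (_ : 2 * _ - 1 = ival t) ?ivalK//; lra.
Qed.

Definition loops_flat_or_full : set (I01 R -> I01 R) :=
  [set g | loops g /\ (height g = 0 \/ height g = 1)].

Lemma loops_flat_or_full_cts g : loops_flat_or_full g -> continuous g.
Proof. by case=> -[]. Qed.

Lemma loops_flat_or_full_ends g :
  loops_flat_or_full g -> [set I0] (g I0) /\ [set I0] (g I1).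
Proof. by case=> -[_ ? ?]. Qed.

Lemma loops_flat_or_full_reparam g phi :
  loops_flat_or_full g -> reparam P phi -> loops_flat_or_full (g \o phi).
Proof.
move=> [lg hg] phiP; split; first exact: loops_reparam lg phiP.
by rewrite height_reparam.
Qed.

Lemma loops_flat_or_full_comp x y : loops_flat_or_full x ->
  loops_flat_or_full y -> x I1 = y I0 -> loops_flat_or_full (norm_comp x y).
Proof.
move=> [lx hx] [ly hy] xy; split; first exact: loops_comp.
rewrite height_norm_comp//.
by case: hx => ->; case: hy => ->; [left|right|right|right];
  rewrite ?maxxx//; [rewrite max_r|rewrite max_l].
Qed.

(** The multipointed d-space on [0, 1] with the single state 0, whose execution
    paths are the loops of height 0 or 1. *)
Definition collapse_space : mdspace R P :=
  @MDSpace R P (I01 R) (@I01_dg R) (@I01_dh R) [set I0] loops_flat_or_full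
    loops_flat_or_full_cts loops_flat_or_full_ends loops_flat_or_full_reparam
    loops_flat_or_full_comp.

Lemma loops_full_flat_or_full g : loops_full g -> loops_flat_or_full g.
Proof. by move=> [lg hg]; split=> //; right. Qed.

Definition collapse_spaceA : mdmap (spaceA R P) collapse_space :=
  @MDMap R P (spaceA R P) collapse_space (fun t => t) (@id_cts R)
    (fun _ u0 => u0) loops_full_flat_or_full.

Lemma height_cst0 : height (cst I0 : I01 R -> I01 R) = 0.
Proof.
apply/eqP; rewrite eq_le; apply/andP; split.
  by apply: height_le => t; rewrite ival0.
by rewrite -[leLHS]ival0; exact: (le_height (cst I0) I0).
Qed.

Lemma loops_flat_or_full_cst0 : loops_flat_or_full (cst I0).
Proof.
by split; [split=> //; exact: cst_continuous|left; exact: height_cst0].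
Qed.

Definition collapse_cst (X : mdspace R P) : mdmap X collapse_space :=
  @MDMap R P X collapse_space (cst I0) (@cst_continuous _ _ I0)
    (fun _ _ => erefl) (fun _ _ => loops_flat_or_full_cst0).

(** The height along a path of execution paths would take the value [1 / 2]. *)
Lemma joined_height (X : mdspace R P) (h : mdmap X collapse_space)
    (x y : Ptop X) : joined_by_path R x y ->
  height (h \o path_fun x) = 0 -> height (h \o path_fun y) = 1 -> False.
Proof.
move=> [p [cp p0 p1]] h0 h1.
pose m (t : I01 R) := height (h \o path_fun (p t)).
have cm : continuous m.
  apply: (@height_continuous R (I01 R) (fun t => h \o path_fun (p t))).
  apply: (cts_comp _ (@mdfun_cts _ _ _ _ h)).
  apply: (@cts_comp (I01 R * I01 R)%type (Ptop X * I01 R)%type X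
    (fun z => (p z.1, z.2)) (fun z => path_fun z.1 z.2)); last first.
    exact: path_fun_continuous.
  apply: cts_pair; last exact: cts_snd.
  by apply: (cts_comp _ cp); exact: cts_fst.
have mE t : m t = 0 \/ m t = 1.
  by have [] := mdfun_paths h (path_fun_paths (p t)).
have cm' : {within `[0, 1], continuous (m \o clamp01 : R -> R)}.
  by apply: continuous_subspaceT; exact: (cts_comp (@clamp01_continuous R) cm).
have [||c _] := @IVT R (m \o clamp01) 0 1 2^-1 _ cm'; first exact: ler01.
  rewrite /= -/I0 -/I1 /m p0 p1 h0 h1; rewrite min_l// max_r//; lra.
by rewrite /=; case: (mE (clamp01 c)) => ->; lra.
Qed.

End Collapse.

(** * The cobase change is not a weak equivalence *)

Lemma disk_boundary0_empty (R : realType) : disk_boundary R 0 -> False.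
Proof.
move=> z; have := set_valP z; rewrite /= big_ord0 => /eqP.
by rewrite eq_sym oner_eq0.
Qed.

Lemma disk0_point (R : realType) : disk R 0.
Proof. by apply: (@set_elt _ _ 0); rewrite /= big_ord0 ler01. Qed.

(** On [pi_0], the classes of the glued segment [k \o d] and of its composition
    with a tent of [A] are distinct in [X] and are identified in [Y]. *)
Lemma pushout_not_weak_equivalence (R : realType) (P : reparam_cat)
    (G0 G1 X Y : mdspace R P) (i : mdmap G0 G1)
    (a : mdmap G0 (spaceA R P)) (j : mdmap (spaceA R P) X)
    (k : mdmap G1 X) (sbar : mdmap X Y) (l : mdmap (spaceB R P) Y) :
  pushout_diagram i a j k sbar l -> ~ weak_equivalence sbar.
Proof.
move=> [[q0 [q1 [q [q0' [q1' [q' [gG0 gG1 iq0 iq1 _]]]]]]] aE poX poY].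
move=> [_ [[pi0 _] _]].
have [_ univ0 sG0 _] := gG0; have [[_ q'0 q'1] _ sG1 pG1] := gG1.
(* Only the states of [G0] are known to go to 0; that there are no other points
   is the uniqueness part of the universal property of a globe on the empty
   space. *)
have a0 x : a x = I0.
  have [|||||h [_ _ _ _ hE]] := univ0 (I01 R) I0 I0 (fun=> I0).
  - exact: I01_dg.
  - exact: I01_dh.
  - exact: cst_continuous.
  - by [].
  - by [].
  have aq0 : a q0 = I0 by apply: aE; rewrite sG0; left.
  have aq1 : a q1 = I0 by apply: aE; rewrite sG0; right.
  have noq (f g : kelley R (disk_boundary R 0 * I01 R)%type -> I01 R) : f =1 g.
    by move=> [z]; case: (@disk_boundary0_empty R z).
  rewrite (hE a (@mdfun_cts _ _ _ _ a) aq0 aq1 (noq _ _) x).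
  symmetry; apply: (hE (cst I0) (@cst_continuous _ _ I0)) => //.
have D0 := disk0_point R.
pose d (t : I01 R) : G1 := q' (D0, t).
have pd : paths G1 d by rewrite pG1; exists D0, id => //; exact: reparam_id.
have [jk _] := poX; have [sl univY] := poY.
have kd0 : k (d I0) = j I0.
  by rewrite /d q'0 -iq0 -[LHS]/((k \o i) q0) -jk /= a0.
have kd1 : k (d I1) = j I0.
  by rewrite /d q'1 -iq1 -[LHS]/((k \o i) q1) -jk /= a0.
have pkd : paths X (k \o d) by exact: mdfun_paths.
have pjT : paths X (j \o @tent R) by apply: mdfun_paths; exact: loops_full_tent.
have [[_ T0 T1] hT] := loops_full_tent R.
have pc : paths X (norm_comp (j \o @tent R) (k \o d)).
  by apply: paths_comp => //=; rewrite T1 kd0.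
have sj : states X (j I0) by exact: mdfun_states.
have lift (c : I01 R -> X) : paths X c -> c I0 = j I0 -> c I1 = j I0 ->
    exists x : Ptop X, path_fun x = c.
  move=> pcc c0 c1.
  have [|||||||Phi _ PhiE] := @Ptop_lift R P X (I01 R) (fun=> c) (j I0) (j I0) => //.
  - exact: I01_dg.
  - by apply: (cts_comp (@cts_snd _ _)); exact: paths_cts.
  by exists (Phi I0).
have [x xE] := lift _ pkd kd0 kd1.
have [y yE] : exists y : Ptop X, path_fun y = norm_comp (j \o @tent R) (k \o d).
  by apply: lift; rewrite ?norm_comp0 ?norm_comp1//= T0.
have jxy : joined_by_path R x y.
  apply: pi0.
  have slI : sbar (j I0) = l I0 by exact: sl.
  have [|||p [cp p0 p1]] := @shrinking_path R P Y l (sbar \o k \o d).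
  - exact: (mdfun_paths sbar pkd).
  - by rewrite /= kd0.
  - by rewrite /= kd1.
  exists p; split=> //; apply: path_fun_inj.
    by rewrite p0 -[RHS]/(sbar \o path_fun x) xE.
  rewrite p1 -[RHS]/(sbar \o path_fun y) yE; apply/funext => t.
  by rewrite /= /norm_comp; case: ifP => _ //=; rewrite -[RHS]/((sbar \o j) _) sl.
have [|h [hj hk _]] := poX.2 _ (collapse_spaceA R P) (collapse_cst G1).
  by move=> z /=; rewrite a0.
apply: (@joined_height R P X h x y jxy).
  rewrite xE (_ : _ \o _ = cst I0) ?height_cst0//.
  by apply/funext => t; exact: hk.
rewrite yE (_ : _ \o _ = norm_comp (@tent R) (cst I0)).
  by rewrite height_norm_comp// hT height_cst0 max_l.
apply/funext => t; rewrite /= /norm_comp; case: ifP => _ /=; first exact: hj.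
exact: hk.
Qed.

(** * Existence of the pushouts *)

Section GeneratedSpace.
Variables (R : realType) (P : reparam_cat) (T : topologicalType).
Variables (dgT : delta_generated R T) (dhT : delta_hausdorff R T).
Variables (S : set T) (G : set (I01 R -> T)).
Hypothesis G_cts : forall g, G g -> continuous g.
Hypothesis G_ends : forall g, G g -> S (g I0) /\ S (g I1).

(** The least set of paths that contains [G] and is closed under
    reparametrization and normalized composition. *)
Inductive generated_path : (I01 R -> T) -> Prop :=
| generated_gen g : G g -> generated_path g
| generated_reparam g phi :
    generated_path g -> reparam P phi -> generated_path (g \o phi)
| generated_comp x y : generated_path x -> generated_path y -> x I1 = y I0 ->
    generated_path (norm_comp x y).

Lemma generated_path_cts g : generated_path g -> continuous g.
Proof.
elim=> {g} [g /G_cts//|g phi _ cg phiP|x y _ cx _ cy xy].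
  exact: (cts_comp (reparam_continuous phiP) cg).
exact: norm_comp_continuous.
Qed.

Lemma generated_path_ends g : generated_path g -> S (g I0) /\ S (g I1).
Proof.
elim=> {g} [g /G_ends//|g phi _ [g0 g1] phiP|x y _ [x0 _] _ [_ y1] _].
  by have [p0 p1] := reparam_ends phiP; rewrite /= p0 p1.
by rewrite norm_comp0 norm_comp1.
Qed.

Definition generated_space : mdspace R P :=
  @MDSpace R P T dgT dhT S generated_path generated_path_cts
    generated_path_ends generated_reparam generated_comp.

Lemma generated_path_map (Z : mdspace R P) (h : T -> Z) :
  (forall g, G g -> paths Z (h \o g)) ->
  forall g, generated_path g -> paths Z (h \o g).
Proof.
move=> hG g; elim=> {g} [g /hG//|g phi _ pg phiP|x y _ px _ py xy].
  exact: (paths_reparam pg phiP).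
rewrite (_ : _ \o _ = norm_comp (h \o x) (h \o y)).
  by apply: paths_comp => //=; rewrite xy.
by apply/funext => t; rewrite /= /norm_comp; case: ifP.
Qed.

End GeneratedSpace.

Section Globes.
Variables (R : realType) (P : reparam_cat).

Lemma is_globe_empty :
  @is_globe R P (disk_boundary R 0) (discrete_md R P bool) false true
    (fun=> false).
Proof.
have E := @disk_boundary0_empty R; split.
- by split=> [|//|z]; [exact: cst_continuous|case: (E z)].
- move=> W w0 w1 r _ _ _ _ _; exists (fun b : bool => if b then w1 else w0).
  split=> //.
  + exact: discrete_cts.
  + by move=> [z]; case: (E z).
  + by move=> h' _ h0 h1 _ [|].
- by apply/seteqP; split=> -[] // _; [right|left].
- by apply/seteqP; split=> // g [z]; case: (E z).
Qed.

Lemma I01_neq : (I1 : I01 R) <> I0.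
Proof. by move=> /(congr1 ival); rewrite ival0 ival1 => /eqP; rewrite oner_eq0. Qed.

Lemma reparam_comp (g phi : I01 R -> I01 R) :
  reparam P g -> reparam P phi -> reparam P (g \o phi).
Proof.
case: P => /=.
  move=> [mg cg [g' [cg' gK g'K]]] [mp cp [p' [cp' pK p'K]]]; split.
  - by move=> s t st; exact/mg/mp.
  - exact: (cts_comp cp cg).
  - exists (p' \o g'); split; [exact: (cts_comp cg' cp')|exact: can_comp|].
    exact: can_comp.
move=> [mg sg] [mp sp]; split; first by move=> s t st; exact/mg/mp.
by move=> y _; have [x _ <-] := sg y I; have [z _ <-] := sp x I; exists z.
Qed.

Lemma reparam_states (g : I01 R -> I01 R) :
  reparam P g -> [set I0; I1] (g I0) /\ [set I0; I1] (g I1).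
Proof. by move=> /reparam_ends[-> ->]; split; [left|right]. Qed.

Lemma reparam_norm_comp (x y : I01 R -> I01 R) :
  reparam P x -> reparam P y -> x I1 = y I0 -> reparam P (norm_comp x y).
Proof.
by move=> /reparam_ends[_ ->] /reparam_ends[-> _] /I01_neq.
Qed.

(** The interval [0, 1] with the states 0 and 1, whose execution paths are the
    reparametrizations: a model of the globe on a point. Two of its execution
    paths are never composable. *)
Definition directed_interval : mdspace R P :=
  @MDSpace R P (I01 R) (@I01_dg R) (@I01_dh R) [set I0; I1] (reparam P)
    (@reparam_continuous R P) reparam_states reparam_comp reparam_norm_comp.

Lemma is_globe_point :
  @is_globe R P (disk R 0) directed_interval I0 I1 (fun z => z.2).
Proof.
have D0 := disk0_point R; have D1 (z : disk R 0) : z = D0.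
  by apply: val_inj; apply/rowP => -[].
split.
- split=> //; apply: (@cts_comp _ (disk R 0 * I01 R)%type).
    exact: kelley_id_continuous.
  exact: cts_snd.
- move=> W w0 w1 r _ _ cr r0 r1; exists (fun t => r (D0, t)); split=> //.
  + apply: (cts_comp _ cr); apply: continuous_kelley; first exact: I01_dg.
    by apply: cts_pair; [exact: cst_continuous|exact: id_cts].
  + by move=> [z t] /=; rewrite (D1 z).
  + by move=> h' _ _ _ hq t; rewrite -hq.
- by [].
- apply/seteqP; split=> [g gP|_ [_ [phi phiP ->]]//].
  by exists D0, g.
Qed.

End Globes.

Section Wedge.
Variable R : realType.

(** A planar model of the segment [0, 1] with the two ends of a second segment
    glued to its point 0. The first segment is laid on the negative first axis.
    The second one becomes a closed curve in the half-plane of nonnegative first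
    coordinate, on which the parameter is the ratio of the coordinates away from
    the origin. *)
Definition lollipop_segment (t : I01 R) : R * R := (- ival t, 0).

Definition lollipop_circle (t : I01 R) : R * R :=
  (ival t * (1 - ival t), ival t * (ival t * (1 - ival t))).

Definition lollipop : topologicalType :=
  set_type (range lollipop_segment `|` range lollipop_circle).

Lemma lollipop_inl_subproof t :
  (range lollipop_segment `|` range lollipop_circle) (lollipop_segment t).
Proof. by left; exists t. Qed.

Lemma lollipop_inr_subproof t :
  (range lollipop_segment `|` range lollipop_circle) (lollipop_circle t).
Proof. by right; exists t. Qed.

Definition lollipop_inl (t : I01 R) : lollipop := set_elt (lollipop_inl_subproof t).

Definition lollipop_inr (t : I01 R) : lollipop := set_elt (lollipop_inr_subproof t).

Lemma lollipopP (w : lollipop) :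
  (exists t, w = lollipop_inl t) \/ (exists t, w = lollipop_inr t).
Proof.
have [[t _ tw]|[t _ tw]] := set_valP w; [left|right]; exists t; exact: val_inj.
Qed.

Lemma lollipop_inl_continuous : continuous lollipop_inl.
Proof.
apply: continuous_comp_initial; apply: cts_pair; last exact: cst_continuous.
exact: (cts_opp (@ival_continuous R)).
Qed.

Lemma lollipop_inr_continuous : continuous lollipop_inr.
Proof.
have civ := @ival_continuous R.
have c1 := cts_mul civ (cts_sub (@cst_continuous _ R (1 : R)) civ).
by apply: continuous_comp_initial; exact: cts_pair c1 (cts_mul civ c1).
Qed.

Lemma lollipop_inr0 : lollipop_inr I0 = lollipop_inl I0.
Proof.
by apply: val_inj; rewrite /= /lollipop_circle /lollipop_segment ival0 !mul0r oppr0.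
Qed.

Lemma lollipop_inr1 : lollipop_inr I1 = lollipop_inl I0.
Proof.
apply: val_inj; rewrite /= /lollipop_circle /lollipop_segment ival0 ival1.
by rewrite subrr !mulr0 oppr0.
Qed.

Lemma lollipop_hausdorff : hausdorff_space lollipop.
Proof.
have csv : continuous (set_val : lollipop -> R * R) by exact: initial_continuous.
move=> x y clxy; apply: val_inj.
have Hfst : continuous (fun w : lollipop => (set_val w).1).
  exact: (cts_comp csv (@cts_fst _ _)).
have Hsnd : continuous (fun w : lollipop => (set_val w).2).
  exact: (cts_comp csv (@cts_snd _ _)).
have E (f : lollipop -> R) : continuous f -> f x = f y.
  move=> cf; apply: (@Rhausdorff R) => A B Ax By.
  by have [z [Az Bz]] := clxy _ _ (cf _ _ Ax) (cf _ _ By); exists (f z).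
by apply: injective_projections; [exact: E Hfst|exact: E Hsnd].
Qed.

(** The lollipop has the quotient topology of its two segments: these are
    compact, and the lollipop is Hausdorff. *)
Lemma lollipop_open (A : set lollipop) :
  open (lollipop_inl @^-1` A) -> open (lollipop_inr @^-1` A) -> open A.
Proof.
move=> oA1 oA2; rewrite -(setCK A); apply: closed_openC.
have -> : ~` A = (lollipop_inl @` (~` (lollipop_inl @^-1` A)))
             `|` (lollipop_inr @` (~` (lollipop_inr @^-1` A))).
  apply/seteqP; split=> [w nA|w [[t nt <-]|[t nt <-]]//].
  by have [[t wt]|[t wt]] := lollipopP w; [left|right]; exists t => //=; rewrite -wt.
have cl (f : I01 R -> lollipop) : continuous f -> open (f @^-1` A) ->
    closed (f @` (~` (f @^-1` A))).
  move=> cf oA; apply: compact_closed; first exact: lollipop_hausdorff.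
  apply: continuous_compact; first exact: continuous_subspaceT.
  apply: (subclosed_compact _ (@I01_compact R)) => //.
  exact: open_closedC.
apply: closedU; apply: cl => //; first exact: lollipop_inl_continuous.
exact: lollipop_inr_continuous.
Qed.

Lemma lollipop_dg : delta_generated R lollipop.
Proof.
move=> A oA; apply: lollipop_open; apply: oA; first exact: lollipop_inl_continuous.
exact: lollipop_inr_continuous.
Qed.

Lemma lollipop_dh : delta_hausdorff R lollipop.
Proof.
move=> p cp; apply: compact_closed; first exact: lollipop_hausdorff.
apply: continuous_compact; first exact: continuous_subspaceT.
exact: I01_compact.
Qed.

(** The universal property of the wedge. *)
Lemma lollipop_rec (T : topologicalType) (u v : I01 R -> T) :
  continuous u -> continuous v -> v I0 = u I0 -> v I1 = u I0 ->
  exists h : lollipop -> T, [/\ continuous h, forall t, h (lollipop_inl t) = u t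
                           & forall t, h (lollipop_inr t) = v t].
Proof.
move=> cu cv v0 v1.
pose h (w : lollipop) := let z := set_val w in
  if z.1 <= 0 then u (clamp01 (- z.1)) else v (clamp01 (z.2 / z.1)).
have hl t : h (lollipop_inl t) = u t.
  rewrite /h /= /lollipop_segment /= oppr_le0 opprK ivalK.
  by have /andP[-> _] := ival01 t.
have hr t : h (lollipop_inr t) = v t.
  rewrite /h /= /lollipop_circle /=; have /andP[t0 t1] := ival01 t.
  have [tp|] := ltP 0 (ival t * (1 - ival t)).
    by rewrite mulfK ?gt_eqF// ivalK.
  move=> le0; have /eqP : ival t * (1 - ival t) = 0.
    by apply/eqP; rewrite eq_le le0 mulr_ge0// subr_ge0.
  rewrite mulf_eq0 subr_eq0 => /orP[/eqP t00|/eqP t11].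
    have -> : t = I0 by apply: ival_inj; rewrite ival0.
    by rewrite ival0 mul0r oppr0 v0.
  have -> : t = I1 by apply: ival_inj; rewrite ival1.
  by rewrite ival1 subrr mulr0 oppr0 v1.
exists h; split=> //; apply/continuousP => A oA.
apply: lollipop_open; rewrite -comp_preimage.
  rewrite (_ : h \o _ = u); last by apply/funext.
  by move/continuousP: cu; apply.
rewrite (_ : h \o _ = v); last by apply/funext.
by move/continuousP: cv; apply.
Qed.

Variable P : reparam_cat.

Section WedgeSpace.
Variable (L : set (I01 R -> I01 R)) (Ll : L `<=` @loops R).

(** The loops of [L] on the segment and the directed runs around the curve. *)
Definition lollipop_generators : set (I01 R -> lollipop) :=
  [set g | (exists2 f, L f & g = lollipop_inl \o f) \/
           (exists2 phi, reparam P phi & g = lollipop_inr \o phi)].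

Lemma lollipop_generators_cts g : lollipop_generators g -> continuous g.
Proof.
case=> -[f Lf ->].
  by have [cf _ _] := Ll Lf; exact: (cts_comp cf lollipop_inl_continuous).
exact: (cts_comp (reparam_continuous Lf) lollipop_inr_continuous).
Qed.

Lemma lollipop_generators_ends g : lollipop_generators g ->
  [set lollipop_inl I0] (g I0) /\ [set lollipop_inl I0] (g I1).
Proof.
case=> -[f Lf ->] /=; first by have [_ -> ->] := Ll Lf.
by have [-> ->] := reparam_ends Lf; rewrite lollipop_inr0 lollipop_inr1.
Qed.

(** This is [X] when [L] consists of the loops of height 1, and [Y] when it
    consists of the nonzero loops. *)
Definition lollipop_space : mdspace R P :=
  generated_space P lollipop_dg lollipop_dh lollipop_generators_cts
    lollipop_generators_ends.

End WedgeSpace.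

Lemma pushout_diagram_exists :
  exists (G0 G1 X Y : mdspace R P) (i : mdmap G0 G1)
        (a : mdmap G0 (spaceA R P)) (j : mdmap (spaceA R P) X)
        (k : mdmap G1 X) (sbar : mdmap X Y) (l : mdmap (spaceB R P) Y),
        pushout_diagram i a j k sbar l.
Proof.
have Lf : @loops_full R `<=` @loops R by move=> g [].
have Ln : @loops_nonzero R `<=` @loops R by move=> g [].
pose X := lollipop_space Lf; pose Y := lollipop_space Ln.
pose G0 := discrete_md R P bool; pose G1 := directed_interval R P.
have is_ (b : bool) : setT b -> [set I0; I1] (if b then I1 else I0 : I01 R).
  by case: b; [right|left].
pose i : mdmap G0 G1 := @MDMap R P G0 G1 (fun b : bool => if b then I1 else I0)
  (@discrete_cts _ _ _) is_
  (fun _ => False_ind _).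
pose a : mdmap G0 (spaceA R P) := @MDMap R P G0 (spaceA R P) (fun=> I0)
  (@discrete_cts _ _ _) (fun _ _ => erefl) (fun _ => False_ind _).
have jp g : loops_full g -> paths X (lollipop_inl \o g).
  by move=> fg; apply: generated_gen; left; exists g.
have lp g : loops_nonzero g -> paths Y (lollipop_inl \o g).
  by move=> fg; apply: generated_gen; left; exists g.
have kp g : reparam P g -> paths X (lollipop_inr \o g).
  by move=> fg; apply: generated_gen; right; exists g.
have js t : [set I0] t -> [set lollipop_inl I0] (lollipop_inl t) by move=> ->.
have ks t : [set I0; I1] t -> [set lollipop_inl I0] (lollipop_inr t).
  by move=> [->|->]; rewrite ?lollipop_inr0 ?lollipop_inr1.
have sp g : paths X g -> paths Y (id \o g).
  apply: (@generated_path_map R P lollipop _ Y id) => {g} g [[f ff ->]|[f ff ->]].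
    exact: lp (loops_full_nonzero ff).
  by apply: generated_gen; right; exists f.
pose j : mdmap (spaceA R P) X :=
  @MDMap R P (spaceA R P) X lollipop_inl lollipop_inl_continuous js jp.
pose l : mdmap (spaceB R P) Y :=
  @MDMap R P (spaceB R P) Y lollipop_inl lollipop_inl_continuous js lp.
pose k : mdmap G1 X := @MDMap R P G1 X lollipop_inr lollipop_inr_continuous ks kp.
have cid : continuous (id : lollipop -> lollipop) by move=> w; exact: cvg_id.
pose sbar : mdmap X Y := @MDMap R P X Y id cid (fun _ s => s) sp.
exists G0, G1, X, Y, i, a, j, k, sbar, l; split.
- exists false, true, (fun=> false), I0, I1, (fun z => z.2); split=> //.
  + exact: is_globe_empty.
  + exact: is_globe_point.
  + by move=> z; case: (@disk_boundary0_empty R z).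
- by [].
- split; first by case; rewrite /= ?lollipop_inr0 ?lollipop_inr1.
  move=> Z u v uv.
  have v0 : v I0 = u I0 by exact: esym (uv false).
  have v1 : v I1 = u I0 by exact: esym (uv true).
  have [h [ch hl hr]] := lollipop_rec (@mdfun_cts _ _ _ _ u)
    (@mdfun_cts _ _ _ _ v) v0 v1.
  have hs w : states X w -> states Z (h w).
    by move=> ->; rewrite hl; exact: mdfun_states.
  have hp g : paths X g -> paths Z (h \o g).
    apply: generated_path_map => {g} g [[f ff ->]|[f ff ->]].
      rewrite (_ : _ \o _ = u \o f); first exact: mdfun_paths.
      by apply/funext => t; exact: hl.
    rewrite (_ : _ \o _ = v \o f); first exact: mdfun_paths.
    by apply/funext => t; exact: hr.
  exists (@MDMap R P X Z h ch hs hp); split=> // h' hj hk w /=.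
  have [[t ->]|[t ->]] := lollipopP w; rewrite ?hl ?hr; [exact: hj|exact: hk].
(* [X] and [Y] have the same underlying space, so that the induced map out of
   [Y] is [u] itself. *)
- split=> // Z u v uv.
  have up g : paths Y g -> paths Z (u \o g).
    apply: generated_path_map => {g} g [[f ff ->]|[f ff ->]].
      rewrite (_ : _ \o _ = v \o f); first exact: mdfun_paths.
      by apply/funext => t; exact: uv.
    exact: (mdfun_paths u (kp f ff)).
  exists (@MDMap R P Y Z u (@mdfun_cts _ _ _ _ u) (@mdfun_states _ _ _ _ u) up).
  by split=> // t; exact: uv.
Qed.

End Wedge.

(** * The theorem *)

Theorem theorem4p3 (R : realType) (P : reparam_cat) :
  [/\ exists (G0 G1 X Y : mdspace R P) (i : mdmap G0 G1)
        (a : mdmap G0 (spaceA R P)) (j : mdmap (spaceA R P) X)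
        (k : mdmap G1 X) (sbar : mdmap X Y) (l : mdmap (spaceB R P) Y),
        pushout_diagram i a j k sbar l,
      forall (G0 G1 X Y : mdspace R P) (i : mdmap G0 G1)
        (a : mdmap G0 (spaceA R P)) (j : mdmap (spaceA R P) X)
        (k : mdmap G1 X) (sbar : mdmap X Y) (l : mdmap (spaceB R P) Y),
        pushout_diagram i a j k sbar l ->
        [/\ generating_qcofibration i, qcofibration j,
            weak_equivalence (map_s R P) & ~ weak_equivalence sbar]
    & ~ left_proper R P].
Proof.
have main (G0 G1 X Y : mdspace R P) (i : mdmap G0 G1)
    (a : mdmap G0 (spaceA R P)) (j : mdmap (spaceA R P) X)
    (k : mdmap G1 X) (sbar : mdmap X Y) (l : mdmap (spaceB R P) Y) :
    pushout_diagram i a j k sbar l ->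
    [/\ generating_qcofibration i, qcofibration j,
        weak_equivalence (map_s R P) & ~ weak_equivalence sbar].
  move=> D; have [gi _ po _] := D; have gqi := gen_globe gi; split.
  - exact: gqi.
  - exact: pushout_qcofibration gqi po.
  - exact: map_s_weak_equivalence.
  - exact: pushout_not_weak_equivalence D.
have ex := pushout_diagram_exists R P; split=> // lp.
have [G0 [G1 [X [Y [i [a [j [k [sbar [l D]]]]]]]]]] := ex.
have [_ qj ws nws] := main _ _ _ _ _ _ _ _ _ _ D; have [_ _ _ po] := D.
exact/nws/(lp _ _ _ _ _ _ _ _ ws qj po).
Qed.
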